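(* Let $c_0=\frac{1}{\log_2 5+1}\approx 0.301$. For every large enough integer $k$ and every small constant $\varepsilon>0$, there exists a graph $G$ with $k$ terminals such that any convex combination of contraction-based flow sparsifiers of $G$ (with respect to its terminals) on at most $k\cdot 2^{(\log k)^{(1-c_0)+\varepsilon}}$ vertices has quality at least $(\log k)^{c_0-O(\varepsilon)}$.
   Context: All logarithms are base 2. Graphs are undirected, edge-capacitated with capacities $c(e)\ge 1$; $\mathrm{dist}_G$ is the unweighted (hop) shortest-path distance. Given a terminal set $T\subseteq V(G)$, a demand $\mathcal D$ assigns a value $\mathcal D_{t,t'}\ge 0$ (not all zero) to each unordered terminal pair; a multicommodity flow routes $\mathcal D$ if it sends $\mathcal D_{t,t'}$ units between $t$ and $t'$ for every pair. The congestion of a flow is $\max_e(\text{flow on } e)/c(e)$, and $\mathrm{cong}_G(\mathcal D)$ is the minimum congestion of a flow routing $\mathcal D$ in $G$. A graph $H$ with $T\subseteq V(H)$ is a flow sparsifier of $G$ w.r.t. $T$ of quality $q\ge1$ if $\mathrm{cong}_H(\mathcal D)\le \mathrm{cong}_G(\mathcal D)\le q\cdot\mathrm{cong}_H(\mathcal D)$ for every demand $\mathcal D$ on $T$. A partition $\mathcal F$ of $V(G)$ is valid if the terminals lie in distinct parts; the contraction-based flow sparsifier given by a valid partition $\mathcal F$ is the graph obtained from $G$ by contracting each part into a single node, keeping parallel edges and deleting self-loops; its size is $|\mathcal F|$. A convex combination of contraction-based flow sparsifiers is a probability distribution $\mu$ over contraction-based flow sparsifiers; it has size at most $s$ if every sparsifier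 in its support has at most $s$ vertices. Its underlying graph $H_\mu$ is obtained by taking a copy of each $H$ in the support, scaling its capacities by $\Pr_\mu[H]$, and identifying all copies of each terminal; the quality of $\mu$ is the quality of $H_\mu$ as a flow sparsifier. *)

(* Defs.v *)
From HB Require Import structures.
From mathcomp Require Import all_boot all_order all_algebra.
From mathcomp Require Import all_classical all_reals all_analysis.
Set Implicit Arguments. Unset Strict Implicit. Unset Printing Implicit Defensive.
Import Order.TTheory GRing.Theory Num.Theory.
Local Open Scope ring_scope.

Section FlowSparsifiers.
Variable R : realType.

Definition log2 (x : R) : R := ln x / ln 2.

Definition c0 : R := 1 / (log2 5 + 1).

(* An undirected edge-capacitated (multi)graph on the finite vertex type V is
   given by a symmetric capacity function cap : V -> V -> R, where cap u v is
   the total capacity of the (parallel) edges between u and v (0 = no edge).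
   Terminals are given by an injective map term : 'I_k -> V. *)
Definition sym_cap (V : finType) (cap : V -> V -> R) : Prop :=
  (forall u v, cap u v = cap v u) /\ (forall u v, 0 <= cap u v) /\
  (forall u, cap u u = 0).

(* A demand on the k terminals: D i j is the demand of the unordered pair {i,j},
   stored for i < j; nonnegative and not all zero. *)
Definition demand (k : nat) (D : 'I_k -> 'I_k -> R) : Prop :=
  (forall i j : 'I_k, (i < j)%N -> 0 <= D i j) /\
  (exists i j : 'I_k, (i < j)%N /\ 0 < D i j).

(* A multicommodity flow: f i j u v is the flow of commodity {i,j} (i < j)
   sent along the edge {u,v} in direction u -> v. *)
Definition routes (V : finType) (cap : V -> V -> R) (k : nat)
  (term : 'I_k -> V) (D : 'I_k -> 'I_k -> R)
  (f : 'I_k -> 'I_k -> V -> V -> R) : Prop :=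
  forall i j : 'I_k, (i < j)%N ->
    (forall u v, 0 <= f i j u v) /\
    (forall u v, cap u v = 0 -> f i j u v = 0) /\
    (forall v, \sum_(w : V) f i j v w - \sum_(w : V) f i j w v =
       (if v == term i then D i j else if v == term j then - D i j else 0)).

Definition load (V : finType) (k : nat) (f : 'I_k -> 'I_k -> V -> V -> R)
  (u v : V) : R :=
  \sum_(i : 'I_k) \sum_(j : 'I_k | (i < j)%N) (f i j u v + f i j v u).

Definition congestion (V : finType) (cap : V -> V -> R) (k : nat)
  (f : 'I_k -> 'I_k -> V -> V -> R) : R :=
  \big[Num.max/0]_(u : V) \big[Num.max/0]_(v : V | 0 < cap u v)
     (load f u v / cap u v).

(* minimum congestion of routing D (+oo if D cannot be routed) *)
Definition cong (V : finType) (cap : V -> V -> R) (k : nat)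
  (term : 'I_k -> V) (D : 'I_k -> 'I_k -> R) : \bar R :=
  ereal_inf [set (congestion cap f)%:E | f in [set f | routes cap term D f]].

Definition flow_sparsifier (V : finType) (cap : V -> V -> R)
  (W : finType) (capH : W -> W -> R) (k : nat)
  (term : 'I_k -> V) (termH : 'I_k -> W) (q : R) : Prop :=
  1 <= q /\
  forall D, demand D ->
    (cong capH termH D <= cong cap term D)%E /\
    (cong cap term D <= q%:E * cong capH termH D)%E.

(* A partition of V into m nonempty parts, given as a surjection p : V -> 'I_m
   (part a = p^-1 a); it is valid if terminals lie in distinct parts. *)
Definition valid_partition (V : finType) (k m : nat) (term : 'I_k -> V)
  (p : V -> 'I_m) : Prop :=
  (forall a : 'I_m, exists v, p v = a) /\ injective (fun i => p (term i)).

(* The contraction-based flow sparsifier: contract each part into a node,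
   keeping parallel edges (capacities add up) and deleting self-loops. *)
Definition contract_cap (V : finType) (cap : V -> V -> R) (m : nat)
  (p : V -> 'I_m) (a b : 'I_m) : R :=
  if a == b then 0 else \sum_(u : V | p u == a) \sum_(v : V | p v == b) cap u v.

(* A convex combination of contraction-based flow sparsifiers: n sparsifiers,
   the i-th one given by the valid partition p i into m i parts, with
   probability lam i > 0, the probabilities summing to 1.
   Its underlying graph H_mu has vertices 'I_k (the identified terminals) plus
   the nodes (i, a) of the copies; node a of copy i is identified with
   terminal j when a is the part of terminal j. *)
Definition Hmu_vertex (k n : nat) (m : 'I_n -> nat) : finType :=
  ('I_k + {i : 'I_n & 'I_(m i)})%type.

Definition Hmu_embed (V : finType) (k n : nat) (term : 'I_k -> V)
  (m : 'I_n -> nat) (p : forall i : 'I_n, V -> 'I_(m i))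
  (i : 'I_n) (a : 'I_(m i)) : Hmu_vertex k m :=
  match [pick j : 'I_k | p i (term j) == a] with
  | Some j => inl j
  | None => inr (existT (fun i => 'I_(m i)) i a)
  end.

Definition Hmu_cap (V : finType) (cap : V -> V -> R) (k n : nat)
  (term : 'I_k -> V) (m : 'I_n -> nat) (p : forall i : 'I_n, V -> 'I_(m i))
  (lam : 'I_n -> R) (x y : Hmu_vertex k m) : R :=
  \sum_(i : 'I_n) lam i *
    \sum_(a : 'I_(m i) | Hmu_embed term p a == x)
      \sum_(b : 'I_(m i) | Hmu_embed term p b == y) contract_cap cap (p i) a b.

Definition Hmu_term (k n : nat) (m : 'I_n -> nat) (j : 'I_k) : Hmu_vertex k m :=
  inl j.

Definition convex_comb (V : finType) (k n : nat) (term : 'I_k -> V)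
  (m : 'I_n -> nat) (p : forall i : 'I_n, V -> 'I_(m i)) (lam : 'I_n -> R)
  : Prop :=
  (forall i, 0 < lam i) /\ \sum_(i : 'I_n) lam i = 1 /\
  (forall i, valid_partition term (p i)).

End FlowSparsifiers.

(* Main.v *)
Require Import Defs.
From HB Require Import structures.
From mathcomp Require Import all_boot all_order all_algebra.
From mathcomp Require Import boolp perm ring lra zify.
Set Implicit Arguments. Unset Strict Implicit. Unset Printing Implicit Defensive.
Import Order.TTheory GRing.Theory Num.Theory.
Local Open Scope ring_scope.

(* Let [U] be split into [k] cells of [M] vertices, join each terminal to all the
   vertices of its cell by edges of length [L ~ log M], and put on [U] the union
   of [d] random permutations, with edges of length 1 and capacity [L].  If no
   demand were routed in [Hmu] with [q0] times less congestion than in this graph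
   [G], then by LP duality some contraction [f], onto fewer than [M k / b] clusters,
   would carry a semimetric dominating the distances of [G] between terminals
   whose total cost is at most [q0] times the total length of [G].  Then most
   edges of [G] become short in it.  The graph of short edges on the clusters has
   a sparse neighbourhood cover of radius [r ~ log k / log b], and this cover has
   so few possible values that, in a union bound over all contractions and all
   covers, a random choice of permutations survives unless many pairs of vertices
   share a cluster of the cover.  Vertices sharing one have their terminals at
   distance [O(q0 (L + r))], while balls of radius [D] in [G] contain only
   [2 ^ O(D)] terminals; hence [q0 (L + r)] is at least of order [log k].  With
   [log M] and [log b] of order [(log k) ^ (1 - c0 + eps)] this gives the bound,
   as [c0 <= 1 / 2]. *)

(** * Sparse covers and the union bound over permutations *)

Section Combinatorics.
Local Open Scope nat_scope.

(* Ball growing: as [#|W| < b ^ r.+1], around any remaining point some ball of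
   radius [i <= r] grows by a factor at most [b] at the next radius; that next
   ball becomes a cluster, and the smaller one is removed. *)
Lemma sparse_cover (W : finType) (e : rel W) (b r : nat) :
  symmetric e -> 0 < b -> #|W| < b ^ r.+1 ->
  exists Z : {set W * W}, [/\ #|Z| <= b * #|W|,
    forall x y, e x y -> exists c, (c, x) \in Z /\ (c, y) \in Z
  & forall c x, (c, x) \in Z ->
      exists s, [/\ path e c s, last c s = x & size s <= r.+1]].
Proof.
move=> eC b_gt0 Wb.
suff H (n : nat) (U : {set W}) : #|U| <= n ->
    exists Z : {set W * W}, [/\ #|Z| <= b * #|U|,
      forall x y, x \in U -> y \in U -> e x y -> exists c, (c, x) \in Z /\ (c, y) \in Z
    & forall c x, (c, x) \in Z ->
        exists s, [/\ path e c s, last c s = x & size s <= r.+1]].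
  have [|Z [Zb Zc Zr]] := H #|W| [set: W]; first exact: max_card.
  exists Z; split=> // [|x y]; first by rewrite cardsT in Zb.
  by apply: Zc; rewrite inE.
elim: n U => [|n IHn] U.
  rewrite leqn0 cards_eq0 => /eqP ->; exists set0.
  by rewrite cards0; split=> // [x y|c x]; rewrite inE.
have [->|[c cU]] := set_0Vmem U.
  by move=> _; exists set0; rewrite cards0; split=> // [x y|? x]; rewrite inE.
move=> Un.
pose B i := iter i (fun S : {set W} =>
  S :|: [set y in U | [exists x in S, e x y]]) [set c].
have Bsub i : B i \subset B i.+1 by exact: subsetUl.
have c0 i : c \in B i.
  by elim: i => [|i IHi]; [rewrite inE|apply: (subsetP (Bsub i))].
have BU i : B i \subset U.
  elim: i => [|i IHi]; first by rewrite sub1set.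
  by rewrite subUset IHi; apply/subsetP => x; rewrite inE => /andP[].
have Bstep i x y : x \in B i -> y \in U -> e x y -> y \in B i.+1.
  move=> xB yU exy; rewrite !inE yU; apply/orP; right.
  by apply/existsP; exists x; rewrite xB.
have Bpath i x : x \in B i -> exists s, [/\ path e c s, last c s = x & size s <= i].
  elim: i x => [|i IHi] x; first by rewrite inE => /eqP ->; exists [::].
  rewrite inE => /orP[/IHi[s [? ? ?]]|]; first by exists s; split=> //; exact: leqW.
  rewrite inE => /andP[_ /existsP[z /andP[/IHi[s [ps ls ss]] ezx]]].
  by exists (rcons s x); rewrite rcons_path ps ls ezx last_rcons size_rcons.
have [i ir Bi] : exists2 i, i <= r & #|B i.+1| <= b * #|B i|.
  have [/'exists_idP[i Bi]|nB] := boolP [exists i : 'I_r.+1, #|B i.+1| <= b * #|B i|].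
    by exists i => //; rewrite -ltnS.
  have grow i : i <= r.+1 -> b ^ i <= #|B i|.
    elim: i => [_|i IHi ir]; first by rewrite cards1.
    have := IHi (ltnW ir); rewrite -(leq_pmul2l b_gt0) -expnS => /leq_trans; apply.
    by move/existsPn/(_ (Ordinal ir)): nB; rewrite -ltnNge => /ltnW.
  have := leq_trans (grow _ (leqnn _)) (max_card _).
  by rewrite leqNgt Wb.
have [|Z [Zb Zc Zr]] := IHn (U :\: B i).
  rewrite -ltnS; apply: leq_trans Un; apply: proper_card.
  by apply/properP; split; [exact: subsetDl|exists c; rewrite // inE c0].
exists ([set (c, x) | x in B i.+1] :|: Z); split.
- apply: leq_trans (leq_card_setU _ _) _; rewrite card_imset; last by move=> ? ? [].
  apply: leq_trans (leq_add Bi Zb) _; rewrite -mulnDr leq_mul2l.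
  by rewrite -[#|U|](cardsID (B i)) (setIidPr (BU i)) leqnn orbT.
- move=> x y xU yU exy.
  (* An edge with an end in the removed ball [B i] lies inside the new cluster [B i.+1]; every other
     edge survives among the remaining points. *)
  have [xB|xB] := boolP (x \in B i).
    exists c; split; rewrite inE; apply/orP; left; apply: imset_f.
      exact: (subsetP (Bsub i)).
    exact: Bstep exy.
  have [yB|yB] := boolP (y \in B i).
    exists c; split; rewrite inE; apply/orP; left; apply: imset_f.
      by apply: Bstep yB xU _; rewrite eC.
    exact: (subsetP (Bsub i)).
  have [| |c' [cx cy]] := Zc x y _ _ exy; rewrite ?inE ?xB ?yB //.
  by exists c'; rewrite !inE cx cy !orbT.
- move=> c' x; rewrite inE => /orP[/imsetP[z zB [-> ->]]|/Zr //].
  have [s [ps ls ss]] := Bpath _ _ zB; exists s; split=> //.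
  by apply: leq_trans ss _.
Qed.

(** All factors of the falling factorial [n.*2 ^_ n] are at least [n], and ['C(n.*2, n)] is at most
    [2 ^ n.*2]. The bound transfers counts from arbitrary functions to permutations. *)
Lemma expnn_le_fact (n : nat) : n ^ n <= 4 ^ n * n`!.
Proof.
have /leq_trans -> // : n ^ n <= 'C(n.*2, n) * n`!.
  have H i : i <= n -> n ^ i <= n.*2 ^_ i.
    elim: i => [|i IHi] lein; first by rewrite ffactn0.
    by rewrite expnSr ffactnSr leq_mul ?IHi ?(ltnW lein) //; lia.
  by rewrite bin_ffact H.
rewrite leq_mul2r; apply/orP; right.
rewrite (_ : 4 ^ n = 2 ^ n.*2); last by rewrite -muln2 mulnC expnM.
have -> : 2 ^ n.*2 = \sum_(i < n.*2.+1) 'C(n.*2, i).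
  by rewrite -[2](addn1 1) expnDn; apply: eq_bigr => i _; rewrite !exp1n !muln1.
have nn : n < n.*2.+1 by lia.
by rewrite (bigD1 (Ordinal nn)) //= leq_addr.
Qed.

(** The count is a product over the points, in which each point of [E] loses a factor [B]. *)
Lemma card_family_le (X U : finType) (E : {set X}) (P : X -> pred U) (B : nat) :
  (forall x, #|P x| * B <= #|U|) ->
  #|[set g : {ffun X -> U} | [forall x in E, P x (g x)]]| * B ^ #|E|
    <= #|U| ^ #|X|.
Proof.
move=> PB; pose F x : pred U := if x \in E then P x else predT.
have -> : #|[set g : {ffun X -> U} | [forall x in E, P x (g x)]]| = \prod_x #|F x|.
  have := card_family F; rewrite foldrE big_map big_enum /= => <-.
  apply: eq_card => g; rewrite inE; apply/forall_inP/familyP => gP x.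
    by rewrite /F; case: ifP => [/gP|].
  by move=> xE; have := gP x; rewrite /F xE.
have -> : B ^ #|E| = \prod_x (if x \in E then B else 1).
  by rewrite -big_mkcond prod_nat_const.
have -> : #|U| ^ #|X| = \prod_(x : X) #|U| by rewrite prod_nat_const.
rewrite -big_split /=.
apply: leq_prod => x _; rewrite /F; case: ifP => [_|_]; first exact: PB.
by rewrite muln1.
Qed.

Lemma card_bigcup_le (I T : finType) (Q : pred I) (F : I -> {set T}) :
  #|\bigcup_(i | Q i) F i| <= \sum_(i | Q i) #|F i|.
Proof.
apply: (big_rec2 (fun (A : {set T}) s => #|A| <= s)) => [|i s A _ le]; first by rewrite cards0.
by apply: leq_trans (leq_card_setU _ _) _; rewrite leq_add2l.
Qed.

(** Union bound by counting. A choice that is bad for [c] obeys [P c] on some set [E] of at least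
    half of the [d * #|U|] points. Among all functions, those obeying [P c] on a fixed such [E] are
    a share of at most [1 / beta ^ (d * #|U|)]. Per point, the factor 8 is 2 for the choice of [E]
    times 4 for passing from functions to permutations. *)
Lemma exists_perms (U Cert : finType) (d beta : nat) (P : Cert -> rel U) :
  0 < beta -> #|Cert| * 8 ^ (d * #|U|) < beta ^ (d * #|U|) ->
  exists pi : {ffun 'I_d -> {perm U}}, forall c,
    (forall u, #|P c u| * beta ^ 2 <= #|U|) ->
    2 * #|[set x : 'I_d * U | P c x.2 (pi x.1 x.2)]| < d * #|U|.
Proof.
set N := #|U| => beta_gt0 lt.
pose X : finType := ('I_d * U)%type; have cX : #|X| = d * N by rewrite card_prod card_ord.
pose hits c (g : {ffun X -> U}) := [set x : X | P c x.2 (g x)].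
pose sparse c := [forall u, #|P c u| * beta ^ 2 <= N].
pose bad c := [set g : {ffun X -> U} | sparse c && (d * N <= 2 * #|hits c g|)].
have badle c : #|bad c| * beta ^ (d * N) <= 2 ^ (d * N) * N ^ (d * N).
  have [spc|nsc] := boolP (sparse c); last first.
    by rewrite (_ : bad c = set0) ?cards0 //; apply/setP => g; rewrite !inE (negPf nsc).
  have /forallP sc := spc.
  pose fam (E : {set X}) := [set g : {ffun X -> U} | [forall x in E, P c x.2 (g x)]].
  apply: (@leq_trans (\sum_(E : {set X} | d * N <= 2 * #|E|) #|fam E| * beta ^ (d * N))).
    rewrite -big_distrl leq_mul2r; apply/orP; right => /=.
    apply: (@leq_trans #|\bigcup_(E : {set X} | d * N <= 2 * #|E|) fam E|).
      apply: subset_leq_card; apply/subsetP => g; rewrite inE spc => gb.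
      apply/bigcupP; exists (hits c g) => //.
      by rewrite inE; apply/forall_inP => x; rewrite inE.
    exact: card_bigcup_le.
  apply: (@leq_trans (\sum_(E : {set X} | d * N <= 2 * #|E|) N ^ (d * N))).
    apply: leq_sum => E dE.
    have := @card_family_le X U E (fun x => P c x.2) (beta ^ 2) (fun x => sc x.2).
    rewrite cX; apply: leq_trans; rewrite leq_mul2l; apply/orP; right.
    by rewrite -expnM leq_pexp2l.
  rewrite sum_nat_const leq_mul2r; apply/orP; right.
  apply: leq_trans (max_card _) _.
  by rewrite -cardsT -powersetT card_powerset cardsT cX.
(* Tuples of permutations are embedded into the functions among which the bad ones were counted. *)
pose g (pi : {ffun 'I_d -> {perm U}}) : {ffun X -> U} := [ffun x => pi x.1 x.2].
have gI : injective g.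
  move=> pi1 pi2 /ffunP e; apply/ffunP => i; apply/permP => u.
  by have := e (i, u); rewrite !ffunE.
have cardpi : #|{ffun 'I_d -> {perm U}}| = N`! ^ d.
  rewrite card_ffun card_ord; congr (_ ^ _).
  rewrite -[N]cardsT -card_perm; apply: eq_card => s.
  by rewrite !inE; apply/esym/subsetP => x _; rewrite inE.
have [/existsP[pi /forallP piP]|npi] := boolP [exists pi, [forall c, g pi \notin bad c]].
  exists pi => c sc; have := piP c; rewrite inE negb_and -ltnNge.
  have -> : sparse c by apply/forallP => u; exact: sc.
  rewrite (_ : hits c (g pi) = [set x : X | P c x.2 (pi x.1 x.2)]) //.
  by apply/setP => x; rewrite !inE ffunE.
move: lt; rewrite ltnNge => /negP[].
have : N`! ^ d <= \sum_c #|bad c|.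
  rewrite -cardpi -cardsT -(card_imset _ gI); apply: leq_trans (card_bigcup_le _ _).
  apply: subset_leq_card; apply/subsetP => _ /imsetP[pi _ ->].
  move/existsPn/(_ pi)/forallPn: npi => [c]; rewrite negbK => gb.
  by apply/bigcupP; exists c.
rewrite -(leq_pmul2r (m := beta ^ (d * N))) ?expn_gt0 ?beta_gt0 // big_distrl /=.
move=> /leq_trans le; have {}le := le _ (leq_sum _ (fun c _ => badle c)).
have fact_le : N ^ (d * N) <= 4 ^ (d * N) * N`! ^ d.
  by rewrite ![d * N]mulnC !expnM -expnMn; case: (d) => // d'; rewrite leq_exp2r // expnn_le_fact.
have NN_gt0 : 0 < N ^ (d * N) by rewrite expn_gt0; case: (N) => //; rewrite muln0.
rewrite -(leq_pmul2l NN_gt0).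
apply: leq_trans (leq_mul fact_le (leqnn _)) _; rewrite -mulnA.
apply: leq_trans (leq_mul (leqnn _) le) _.
rewrite sum_nat_const (_ : 8 = 4 * 2) // expnMn; apply: eq_leq; ring.
Qed.

End Combinatorics.

(** * Distances in the instance *)

Section Reach.
Local Open Scope nat_scope.
Variables (V : finType) (e1 e2 : rel V) (L : nat).

(* [reach x n v]: some walk from [x] to [v] has length at most [n], where the
   edges of [e1] have length 1 and those of [e2] have length [L]. *)
Inductive reach (x : V) : nat -> V -> Prop :=
| reach0 : reach x 0 x
| reachS n v : reach x n v -> reach x n.+1 v
| reach1 n u v : reach x n u -> e1 u v -> reach x n.+1 v
| reach2 n u v : reach x n u -> e2 u v -> reach x (n + L) v.

Lemma reach_leq x n m v : n <= m -> reach x n v -> reach x m v.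
Proof.
move=> /subnK <- xv; elim: (m - n) => [//|i IHi]; rewrite addSn; exact: reachS.
Qed.

Lemma reach_trans x y z n m : reach x n y -> reach y m z -> reach x (n + m) z.
Proof.
move=> xy; elim=> [|i v _ IH|i u v _ IH e|i u v _ IH e].
- by rewrite addn0.
- by rewrite addnS; apply: reachS.
- by rewrite addnS; apply: reach1 IH e.
- by rewrite addnA; apply: reach2 IH e.
Qed.

Lemma reach_sym x n v : symmetric e1 -> symmetric e2 -> reach x n v -> reach v n x.
Proof.
move=> e1C e2C; elim=> [|i w _ IH|i u w _ IH e|i u w _ IH e].
- exact: reach0.
- exact: reachS.
- rewrite -add1n; apply: reach_trans IH.
  by apply: reach1 (reach0 _) _; rewrite e1C.
- rewrite addnC; apply: reach_trans IH; rewrite -[L]add0n.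
  by apply: reach2 (reach0 _) _; rewrite e2C.
Qed.

Definition ball x n : {set V} := [set v | `[< reach x n v >]].

(** A point at radius [n.+1] lies in the ball of radius [n], or is an [e1]-neighbour of it, or is an
    [e2]-neighbour of the ball of radius [n.+1 - L]. These contribute at most [C ^ n], [d1 * C ^ n]
    and again [C ^ n] points, whence [d1.+2 <= C]. *)
Lemma card_ball (d1 d2 C : nat) x n : 0 < L ->
  (forall u, #|e1 u| <= d1) -> (forall u, #|e2 u| <= d2) ->
  d1.+2 <= C -> d2 <= C ^ L.-1 -> #|ball x n| <= C ^ n.
Proof.
move=> L_gt0 e1d e2d d1C d2C; have C_gt0 : 0 < C by apply: leq_trans d1C.
elim/ltn_ind: n => -[_|n IHn].
  rewrite expn0 -(cards1 x); apply: subset_leq_card; apply/subsetP => v.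
  rewrite !inE => /asboolP; move e0 : 0 => n xv.
  by case: xv e0 => // i u w _ _; lia.
pose nb (e : rel V) (S : {set V}) : {set V} := (\bigcup_(u in S) [set v | e u v]).
have nb_le e (S : {set V}) d' : (forall u, #|e u| <= d') -> #|nb e S| <= #|S| * d'.
  move=> ed; apply: leq_trans (card_bigcup_le _ _) _.
  rewrite -sum_nat_const; apply: leq_sum => u _.
  by apply: leq_trans (ed u); apply: eq_leq; apply: eq_card => v; rewrite inE.
pose far := if L <= n.+1 then nb e2 (ball x (n.+1 - L)) else set0.
have far_le : #|far| <= C ^ n.
  rewrite /far; case: ifP => [Ln|_]; last by rewrite cards0.
  apply: leq_trans (nb_le _ _ _ e2d) _; have lt : n.+1 - L < n.+1 by lia.
  apply: leq_trans (leq_mul (IHn _ lt) d2C) _.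
  by rewrite -expnD (_ : n.+1 - L + L.-1 = n) //; lia.
apply: (@leq_trans #|(ball x n :|: nb e1 (ball x n) :|: far)|).
  apply: subset_leq_card; apply/subsetP => v; rewrite inE => /asboolP.
  move en : n.+1 => n' xv; case: xv en => [//|i w xw [->]|i u w xu e [->]|i u w xu e en].
  - by rewrite !inE (introT (asboolP _) xw).
  - rewrite !inE; apply/orP; left; apply/orP; right; apply/bigcupP; exists u.
      by rewrite inE; apply/asboolP.
    by rewrite inE.
  - rewrite in_setU; apply/orP; right; rewrite /far en leq_addl addnK.
    by apply/bigcupP; exists u; rewrite inE //; apply/asboolP.
apply: leq_trans (leq_card_setU _ _) _.
apply: leq_trans (leq_add (leq_card_setU _ _) far_le) _.
apply: (@leq_trans (C ^ n + C ^ n * d1 + C ^ n)).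
  rewrite leq_add2r leq_add ?IHn //; apply: leq_trans (nb_le _ _ _ e1d) _.
  by rewrite leq_mul2r IHn ?orbT.
rewrite expnS; apply: leq_trans (leq_mul d1C (leqnn _)); lia.
Qed.

(** The distance truncated at [D]: [find] returns the length [D] of the list when no shorter walk
    exists, so the function is total, and values below [D] are true distances. *)
Definition dist D x v : nat := find (fun n => `[< reach x n v >]) (iota 0 D).

Lemma dist_le D x n v : reach x n v -> dist D x v <= n.
Proof.
move=> xv; rewrite leqNgt; apply/negP => lt.
have nD : n < D by apply: leq_trans lt _; rewrite -[X in _ <= X](size_iota 0) find_size.
have := before_find 0 lt; rewrite nth_iota // add0n => /asboolP; exact.
Qed.

Lemma dist_lt D x v : dist D x v < D -> reach x (dist D x v) v.
Proof.
move=> lt; have h : has (fun n => `[< reach x n v >]) (iota 0 D).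
  by rewrite has_find size_iota.
by have /asboolP := nth_find 0 h; rewrite nth_iota // add0n.
Qed.

Lemma distxx D x : dist D x x = 0.
Proof. by apply/eqP; rewrite -leqn0; apply: dist_le; exact: reach0. Qed.

Lemma dist_step D x u v n :
  (forall m, reach x m u -> reach x (m + n) v) -> dist D x v <= dist D x u + n.
Proof.
move=> step; have [lt|ge] := ltnP (dist D x u) D.
  by apply: dist_le; apply: step; exact: dist_lt.
apply: leq_trans (leq_trans ge (leq_addr _ _)).
by rewrite /dist -[X in _ <= X](size_iota 0) find_size.
Qed.

End Reach.

(** * The cell graph, and permutations that defeat every cover *)

Section CellGraph.
Local Open Scope nat_scope.
Variables (k M d : nat).
Local Notation U := ('I_k * 'I_M)%type.
Local Notation V := ('I_k + U)%type.

Section Edges.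
Variable pi : {ffun 'I_d -> {perm U}}.

Definition perm_edge (x y : V) : bool := match x, y with
  | inr u, inr v => [exists c, (pi c u == v) || (pi c v == u)]
  | _, _ => false end.

Definition cell_edge (x y : V) : bool := match x, y with
  | inl i, inr u => u.1 == i
  | inr u, inl i => u.1 == i
  | _, _ => false end.

Lemma perm_edgeC : symmetric perm_edge.
Proof. by move=> [i|u] [j|v] //=; apply: eq_existsb => c; rewrite orbC. Qed.

Lemma cell_edgeC : symmetric cell_edge.
Proof. by move=> [i|u] [j|v]. Qed.

Lemma card_perm_edge x : #|perm_edge x| <= 2 * d.
Proof.
case: x => [i|u]; first by rewrite (eq_card (B := pred0)) ?card0 // => -[].
pose h (cb : 'I_d * bool) : V :=
  inr (if cb.2 then pi cb.1 u else ((pi cb.1)^-1)%g u).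
apply: (@leq_trans #|codom h|).
  apply: subset_leq_card; apply/subsetP => -[//|v].
  rewrite unfold_in /= => /existsP[c /orP[/eqP e|/eqP e]].
    by apply/codomP; exists (c, true); rewrite /h /= e.
  by apply/codomP; exists (c, false); rewrite /h /= -e permK.
apply: leq_trans (leq_image_card _ _) _.
by rewrite card_prod card_ord card_bool mulnC.
Qed.

Lemma card_cell_edge x : 0 < M -> #|cell_edge x| <= M.
Proof.
move=> M_gt0; case: x => [i|u].
  pose h (a : 'I_M) : V := inr (i, a).
  apply: (@leq_trans #|codom h|).
    apply: subset_leq_card; apply/subsetP => -[//|[i' a]].
    by rewrite unfold_in /= => /eqP ->; apply/codomP; exists a.
  by apply: leq_trans (leq_image_card _ _) _; rewrite card_ord.
apply: leq_trans M_gt0; rewrite -(card1 (inl u.1 : V)).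
apply: subset_leq_card; apply/subsetP => -[i|//].
by rewrite unfold_in /= => /eqP <-; rewrite inE.
Qed.

End Edges.

(** The permutations are fixed before [W], [F], [short] and [good], so the union bound runs over
    certificates for these. Vertices sharing a cluster with [u] have their terminals in a ball of
    radius [D], hence number at most [C ^ D * M], and [C ^ D * beta ^ 2 <= k] makes this sparse. The
    last numerical condition pays for the number of certificates. *)
Lemma perms_avoid_covers (L D C b r beta : nat) :
  0 < k -> 0 < M -> 0 < d -> 0 < b -> 0 < beta -> 0 < L ->
  (2 * d).+2 <= C -> M <= C ^ L.-1 -> C ^ D * beta ^ 2 <= k ->
  2 * (k * M) ^ 4 * 8 ^ d < beta ^ d ->
  exists pi : {ffun 'I_d -> {perm U}},
    forall (W : finType) (F : U -> W) (short : rel W) (good : {set U}),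
    symmetric short -> b * #|W| <= k * M -> #|W| < b ^ r.+1 ->
    (forall u v, u \in good -> v \in good ->
      (exists c s s', [/\ path short c s, last c s = F u, size s <= r.+1 &
                      [/\ path short c s', last c s' = F v & size s' <= r.+1]]) ->
      reach (perm_edge pi) cell_edge L (inl u.1) D (inl v.1)) ->
    2 * #|[set x : 'I_d * U | [&& x.2 \in good, pi x.1 x.2 \in good
                               & short (F x.2) (F (pi x.1 x.2))]]| < d * (k * M).
Proof.
move=> k_gt0 M_gt0 d_gt0 b_gt0 beta_gt0 L_gt0 dC MC Dk num.
have cU : #|{: U}| = k * M by rewrite card_prod !card_ord.
set N := k * M; have N_gt0 : 0 < N by rewrite muln_gt0 k_gt0.
(* A certificate records the contraction, the cover and the good vertices; it
   does not refer to the permutations. *)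
pose Cert : finType := ({ffun U -> U} * {ffun U -> U * U} * {set U})%type.
pose P (c : Cert) (u v : U) := [&& u \in c.2, v \in c.2 & [exists a, [exists a',
  [&& (c.1.2 a).1 == (c.1.2 a').1, (c.1.2 a).2 == c.1.1 u & (c.1.2 a').2 == c.1.1 v]]]].
have cC : #|Cert| = N ^ N * (N * N) ^ N * 2 ^ N.
  rewrite !card_prod !card_ffun !card_prod !card_ord -/N; congr (_ * _).
  by rewrite -cardsT -powersetT card_powerset cardsT cU.
have [|pi piP] := @exists_perms {: U} Cert d beta P beta_gt0.
  rewrite cC cU -/N !(expnM _ d N) -!expnMn ltn_exp2r //.
  apply: leq_ltn_trans num; rewrite -/N leq_mul2r; apply/orP; right.
  by rewrite (_ : 2 * N ^ 4 = N * (N * N) * 2 * N) ?leq_pmulr //; ring.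
exists pi => W F short good shortC bW Wb near.
have WN : #|W| <= N by apply: leq_trans bW; rewrite leq_pmull.
have WU : #|W| <= #|{: U}| by rewrite cU.
have [Z [Zb Zc Zr]] := sparse_cover shortC b_gt0 Wb.
(* An empty cover means that there are no short edges; otherwise [z0] serves as a default below. *)
have [Z0|[z0 z0Z]] := set_0Vmem Z.
  set S := [set _ | _]; suff -> : S = set0 by rewrite cards0 muln0 muln_gt0 d_gt0.
  apply/setP => x; rewrite !inE; apply/negbTE/and3P => -[_ _ /Zc[c [+ _]]].
  by rewrite Z0 inE.
(* Nodes of [W], which also name the clusters of the cover, are renamed by vertices of [U], so that
   certificates do not depend on [W]. *)
pose h (w : W) : U := enum_val (widen_ord WU (enum_rank w)).
have hI : injective h.
  move=> w w' /enum_val_inj /(congr1 val) /= e; apply: enum_rank_inj.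
  exact: val_inj.
(* [Z] is listed along [U], which is long enough since [#|Z| <= b * #|W| <= k * M]; [z0] pads the
   list. *)
pose zs u := nth z0 (enum Z) (enum_rank (u : U)).
have zsZ u : zs u \in Z.
  rewrite -mem_enum /zs; have [lt|ge] := ltnP (enum_rank u) (size (enum Z)).
    exact: mem_nth.
  by rewrite nth_default // mem_enum.
have zsE z : z \in Z -> exists u, zs u = z.
  rewrite -mem_enum => zZ; have lt : index z (enum Z) < #|{: U}|.
    rewrite cU; apply: leq_trans (leq_trans Zb bW).
    by rewrite cardE index_mem.
  by exists (enum_val (Ordinal lt)); rewrite /zs enum_valK nth_index.
pose cert : Cert := ([ffun u => h (F u)],
  [ffun u => (h (zs u).1, h (zs u).2)], good).
have PE u v : P cert u v -> [/\ u \in good, v \in good &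
    exists c, (c, F u) \in Z /\ (c, F v) \in Z].
  rewrite /P /= => /and3P[ug vg /existsP[a /existsP[a']]]; rewrite !ffunE /=.
  move=> /and3P[/eqP/hI e1 /eqP/hI e2 /eqP/hI e3]; split=> //.
  exists (zs a).1; split; first by rewrite -e2 -surjective_pairing.
  by rewrite -e3 e1 -surjective_pairing.
have PI u v : u \in good -> v \in good -> short (F u) (F v) -> P cert u v.
  move=> ug vg /Zc[c [/zsE[a ea] /zsE[a' ea']]]; rewrite /P /= ug vg /=.
  by apply/existsP; exists a; apply/existsP; exists a'; rewrite !ffunE ea ea' /= !eqxx.
have sparse u : #|P cert u| * beta ^ 2 <= #|{: U}|.
  pose B := ball (perm_edge pi) cell_edge L (inl u.1) D.
  have cB : #|B| <= C ^ D.
    apply: (@card_ball _ _ _ _ (2 * d) M) => // [v|v].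
      exact: card_perm_edge.
    exact: card_cell_edge.
  have cP : #|P cert u| <= C ^ D * M.
    pose I := [set i | inl i \in B].
    have cI : #|I| <= #|B|.
      rewrite -(card_imset I (@inl_inj 'I_k U)); apply: subset_leq_card.
      by apply/subsetP => _ /imsetP[i + ->]; rewrite inE.
    apply: (@leq_trans #|setX I [set: 'I_M]|).
      apply: subset_leq_card; apply/subsetP => v; rewrite unfold_in => /PE[ug vg [c [cu cv]]].
      rewrite !inE andbT; apply/asboolP; apply: near => //.
      have [s [? ? ?]] := Zr _ _ cu; have [s' [? ? ?]] := Zr _ _ cv.
      by exists c, s, s'.
    by rewrite cardsX cardsT card_ord leq_mul2r (leq_trans cI cB) orbT.
  rewrite cU mulnC; apply: leq_trans (leq_mul (leqnn _) cP) _.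
  by rewrite mulnA leq_mul2r mulnC Dk orbT.
have := piP cert sparse; rewrite cU; apply: leq_ltn_trans.
rewrite leq_mul2l /=; apply: subset_leq_card; apply/subsetP => x.
by rewrite !inE => /and3P[? ? ?]; exact: PI.
Qed.

End CellGraph.

From mathcomp Require Import all_classical all_reals all_analysis.

(** * Duality for multicommodity flows *)

Section Farkas.
Variable R : realFieldType.

(** Back substitution for Fourier-Motzkin elimination: the largest lower bound serves, or else the
    smallest upper bound, or else 0. *)
Lemma finite_between (I : finType) (P Q : pred I) (l u : I -> R) :
  (forall p q, P p -> Q q -> l p <= u q) ->
  exists x, (forall p, P p -> l p <= x) /\ (forall q, Q q -> x <= u q).
Proof.
move=> lu; case: (pickP P) => [p0 Pp0|P0].
  case: (@arg_maxP _ _ _ p0 P l Pp0) => p Pp maxp.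
  by exists (l p); split=> // q Qq; exact: lu.
case: (pickP Q) => [q0 Qq0|Q0].
  case: (@arg_minP _ _ _ q0 Q u Qq0) => q Qq minq.
  by exists (u q); split=> // p; rewrite P0.
by exists 0; split=> [p|q]; rewrite ?P0 ?Q0.
Qed.

(* Fourier-Motzkin: the rows of the system without the unknown [x 0] are the
   rows not involving it and the positive combinations of two rows cancelling
   it. *)
Lemma farkas_ord n (I : finType) (A : I -> 'I_n -> R) (b : I -> R) :
  (exists x : 'I_n -> R, forall i, \sum_j A i j * x j <= b i) \/
  (exists y : I -> R, [/\ forall i, 0 <= y i,
     forall j, \sum_i y i * A i j = 0 & \sum_i y i * b i < 0]).
Proof.
elim: n I A b => [|n IHn] I A b.
  case: (pickP (fun i => b i < 0)) => [i0 bi0|b0]; last first.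
    by left; exists (fun=> 0) => i; rewrite big_ord0 leNgt b0.
  right; exists (fun i => (i == i0)%:R); split=> [i|[]//|]; first exact: ler0n.
  rewrite (bigD1 i0) //= eqxx mul1r big1 ?addr0 // => i /negPf ->.
  by rewrite mul0r.
pose c p q : bool := (0 < A p ord0) && (A q ord0 < 0).
pose T (g : I -> R) (r : I + I * I) := match r with
  | inl i => (A i ord0 == 0)%:R * g i
  | inr (p, q) => (c p q)%:R * (A p ord0 * g q - A q ord0 * g p) end.
have [[x xP]|[y [y_ge0 yA yb]]] := IHn _ (fun r j => T (A^~ (lift ord0 j)) r) (T b).
  left; pose rest i := \sum_j A i (lift ord0 j) * x j.
  have [|x0 [lx0 x0u]] := @finite_between I (fun q => A q ord0 < 0)
      (fun p => 0 < A p ord0) (fun i => (b i - rest i) / A i ord0)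
      (fun i => (b i - rest i) / A i ord0).
    move=> q p Aq Ap; have := xP (inr (p, q)); rewrite /= /c Ap Aq /= mul1r.
    under eq_bigr do rewrite mul1r mulrBl -!mulrA.
    rewrite sumrB -!mulr_sumr -!/(rest _) => le1.
    rewrite ler_ndivrMr // mulrAC ler_pdivrMr //; nra.
  exists (fun j => if unlift ord0 j is Some j' then x j' else x0) => i.
  rewrite big_ord_recl unlift_none; under eq_bigr do rewrite liftK.
  rewrite -/(rest i); have [Ai|Ai|Ai] := ltgtP (A i ord0) 0.
  - by have := lx0 _ Ai; rewrite ler_ndivrMr //; lra.
  - by have := x0u _ Ai; rewrite ler_pdivlMr //; lra.
  - have := xP (inl i); rewrite /= Ai eqxx mul1r.
    by under eq_bigr do rewrite mul1r; rewrite mul0r add0r.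
right.
(* Multipliers of the reduced system pulled back to the original rows: row [i] collects its own
   multiplier, those of the pairs where it has the negative coefficient, and those where it has the
   positive one. *)
pose y' i := y (inl i) * (A i ord0 == 0)%:R
  + \sum_p y (inr (p, i)) * (c p i)%:R * A p ord0
  - \sum_q y (inr (i, q)) * (c i q)%:R * A q ord0.
have y'T g : \sum_i y' i * g i = \sum_r y r * T g r.
  rewrite big_sumType /=.
  under eq_bigr do rewrite mulrBl mulrDl.
  rewrite sumrB big_split /= -addrA; congr (_ + _).
    by apply: eq_bigr => i _; rewrite mulrA.
  under eq_bigr do rewrite mulr_suml.
  under [X in _ - X]eq_bigr do rewrite mulr_suml.
  rewrite exchange_big /= !pair_bigA /= -sumrB.
  by apply: eq_bigr => -[p q] _ /=; ring.
exists y'; split=> [i|j|]; last by rewrite y'T.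
- rewrite /y' addr_ge0 ?addr_ge0 ?mulr_ge0 ?ler0n //.
    apply: sumr_ge0 => p _; rewrite /c; have [Ap|] := ltP 0 (A p ord0).
      by rewrite !mulr_ge0 ?ler0n // ltW.
    by rewrite /= mulr0 mul0r.
  rewrite -sumrN; apply: sumr_ge0 => q _; rewrite /c.
  have [Aq|] := ltP (A q ord0) 0; last by rewrite andbF mulr0 mul0r oppr0.
  by rewrite -mulrN !mulr_ge0 ?ler0n // oppr_ge0 ltW.
- rewrite y'T; case: (unliftP ord0 j) => [j' ->|->]; first exact: yA.
  apply: big1 => -[i|[p q]] _ /=; last by rewrite mulrC [A q _ * _]mulrC subrr mulr0 mul0r.
  by case: eqP => [->|_]; rewrite ?mulr0 ?mul0r ?mulr0.
Qed.

(** The sign constraints are added as rows [- x j <= 0]; their multipliers become the slack in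
    [0 <= \sum_i y i * A i j]. *)
Lemma farkas (I J : finType) (A : I -> J -> R) (b : I -> R) :
  (exists x : J -> R, (forall j, 0 <= x j) /\ forall i, \sum_j A i j * x j <= b i) \/
  (exists y : I -> R, [/\ forall i, 0 <= y i,
     forall j, 0 <= \sum_i y i * A i j & \sum_i y i * b i < 0]).
Proof.
have reidx (g : J -> R) : \sum_j g j = \sum_(j < #|J|) g (enum_val j).
  by rewrite (reindex (@enum_val J predT)) //; apply: onW_bij; exact: enum_val_bij.
pose A' (r : I + J) (j : 'I_#|J|) := match r with
  | inl i => A i (enum_val j) | inr j' => - (j' == enum_val j)%:R end.
pose b' (r : I + J) := if r is inl i then b i else 0.
have [[x xP]|[y [y_ge0 yA yb]]] := farkas_ord A' b'.
  left; exists (fun j => x (enum_rank j)); split=> [j|i].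
    have := xP (inr j); rewrite /= (bigD1 (enum_rank j)) //= enum_rankK eqxx.
    rewrite big1 ?addr0; last first.
      move=> j' ne; case: eqP => [e|_]; last by rewrite oppr0 mul0r.
      by move: ne; rewrite e enum_valK eqxx.
    by rewrite mulN1r oppr_le0.
  have := xP (inl i); rewrite /= reidx; congr (_ <= _).
  by apply: eq_bigr => j _; rewrite enum_valK.
right; exists (fun i => y (inl i)); split=> // [j|].
  have := yA (enum_rank j); rewrite big_sumType /= enum_rankK.
  rewrite [X in _ + X](bigD1 j) //= eqxx [X in _ + (_ + X)]big1; last first.
    by move=> j' ne; rewrite (negPf ne) oppr0 mulr0.
  by rewrite addr0 mulrN1; have := y_ge0 (inr j); lra.
by move: yb; rewrite big_sumType /= [X in _ + X]big1 ?addr0 // => j _; rewrite mulr0.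
Qed.

End Farkas.

Section FlowDuality.
Variable R : realType.

(** Farkas' lemma for the linear program choosing both the demands and a flow within the capacities,
    with reward [rho] per unit of demand. [y] comes from the capacity rows and [phi] from
    conservation. The sum [y u v + y v u] appears because [load] counts both directions, so that
    flow from [u] to [v] occurs in the rows of both ordered pairs. *)
Lemma flow_duality (W : finType) (cap : W -> W -> R) (k : nat)
    (term : 'I_k -> W) (rho : 'I_k -> 'I_k -> R) (Q : R) :
  (forall u v, 0 <= cap u v) -> injective term ->
  (exists D f, [/\ forall i j, 0 <= D i j, routes cap term D f,
     forall u v, load f u v <= cap u v
   & Q <= \sum_(i : 'I_k) \sum_(j : 'I_k | (i < j)%N) D i j * rho i j]) \/
  (exists (y : W -> W -> R) (phi : 'I_k -> 'I_k -> W -> R),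
   [/\ forall u v, 0 <= y u v,
     forall i j : 'I_k, (i < j)%N -> forall u v, phi i j v - phi i j u <= y u v + y v u,
     forall i j : 'I_k, (i < j)%N -> rho i j <= phi i j (term j) - phi i j (term i)
   & \sum_u \sum_v y u v * cap u v < Q]).
Proof.
move=> cap_ge0 termI.
(* Columns exist for all ordered pairs of terminals; this factor drops those with [i >= j] from the
   capacity and reward rows. *)
pose lt (i j : 'I_k) : R := (i < j)%N%:R.
pose sgb (s : bool) : R := if s then 1 else -1.
(* a column is a commodity with either an arc or, for [None], the demand *)
pose J := (('I_k * 'I_k) * option (W * W))%type.
(* Rows: conservation, each equation split by the boolean into two inequalities; capacities; total
   reward. *)
pose I := ((('I_k * 'I_k) * (W * bool)) + (W * W) + unit)%type.
pose A (r : I) (c : J) : R := match r, c with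
  | inl (inl (ij, (v, s))), (ij', Some (a, b)) =>
      (ij == ij')%:R * sgb s * ((a == v)%:R - (b == v)%:R)
  | inl (inl (ij, (v, s))), (ij', None) =>
      (ij == ij')%:R * sgb s * ((term ij'.2 == v)%:R - (term ij'.1 == v)%:R)
  | inl (inr (u, v)), (ij', Some (a, b)) =>
      lt ij'.1 ij'.2 * (((a == u) && (b == v))%:R + ((a == v) && (b == u))%:R)
  | inl (inr _), (_, None) => 0
  | inr _, (_, Some _) => 0
  | inr _, (ij', None) => - (lt ij'.1 ij'.2 * rho ij'.1 ij'.2)
  end.
pose b (r : I) : R := match r with
  | inl (inl _) => 0 | inl (inr (u, v)) => cap u v | inr _ => - Q end.
have sum1 (T : finType) (t0 : T) (g : T -> R) : \sum_t (t0 == t)%:R * g t = g t0.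
  rewrite (bigD1 t0) //= eqxx mul1r big1 ?addr0 // => t ne.
  by rewrite eq_sym (negPf ne) mul0r.
have sumo (T : finType) (g : option T -> R) :
    \sum_o g o = g None + \sum_t g (Some t).
  rewrite (bigD1 None) //=; congr (_ + _).
  rewrite (reindex_omap Some id) /=; last by case.
  by apply: eq_bigl => t; rewrite eqxx.
have sump (S T : finType) (g : S * T -> R) : \sum_p g p = \sum_a \sum_b g (a, b).
  by rewrite pair_bigA; apply: eq_bigr => -[].
have sumJ (g : J -> R) :
    \sum_c g c = \sum_ij (g (ij, None) + \sum_a \sum_b g (ij, Some (a, b))).
  rewrite sump; apply: eq_bigr => ij _.
  by rewrite sumo sump.
have sumI (g : I -> R) :
    \sum_r g r = \sum_ij \sum_v (g (inl (inl (ij, (v, true)))) + g (inl (inl (ij, (v, false)))))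
      + \sum_u \sum_v g (inl (inr (u, v))) + g (inr tt).
  rewrite big_sumType big_sumType /=; congr (_ + _ + _).
  - rewrite sump.
    apply: eq_bigr => ij _.
    by rewrite sump; apply: eq_bigr => v _; rewrite big_bool.
  - by rewrite sump.
  - by rewrite (bigD1 tt) //= big1 ?addr0 // => -[].
have sum2 (T : finType) (a0 b0 : T) (g : T -> T -> R) :
    \sum_a \sum_b ((a == a0) && (b == b0))%:R * g a b = g a0 b0.
  rewrite (bigD1 a0) //= (bigD1 b0) //= !eqxx mul1r big1 ?addr0; last first.
    by move=> b' ne; rewrite (negPf ne) mul0r.
  rewrite big1 ?addr0 // => a' ne; apply: big1 => b' _.
  by rewrite (negPf ne) mul0r.
have sumlt (g : 'I_k -> 'I_k -> R) :
    \sum_ij lt ij.1 ij.2 * g ij.1 ij.2 = \sum_(i : 'I_k) \sum_(j : 'I_k | (i < j)%N) g i j.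
  rewrite sump; apply: eq_bigr => i _.
  rewrite [RHS]big_mkcond /=; apply: eq_bigr => j _; rewrite /lt.
  by case: ifP => _; rewrite ?mul1r ?mul0r.
have [[x [x_ge0 xP]]|[y [y_ge0 yA yb]]] := farkas A b.
  left; exists (fun i j => x ((i, j), None)).
  exists (fun i j u v => x ((i, j), Some (u, v))).
  have loadle u v : load (fun i j u v => x ((i, j), Some (u, v))) u v <= cap u v.
    have := xP (inl (inr (u, v))); rewrite sumJ /=; apply: le_trans.
    rewrite le_eqVlt; apply/orP; left; apply/eqP; rewrite /load -sumlt.
    apply: eq_bigr => -[i j] _ /=; rewrite mul0r add0r.
    under eq_bigr do under eq_bigr do rewrite -mulrA mulrDl.
    under eq_bigr do rewrite -mulr_sumr big_split /=.
    by rewrite -mulr_sumr big_split /= !sum2.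
  split=> //.
    move=> i j ij; split=> [u v|]; first exact: x_ge0.
    (* An arc of zero capacity carries no flow, since its flow is at most its load. *)
    split=> [u v cap0|v].
      apply/eqP; rewrite eq_le x_ge0 andbT -cap0; apply: le_trans (loadle u v).
      rewrite /load (bigD1 i) //= (bigD1 j) //= -!addrA lerDl.
      rewrite !addr_ge0 ?sumr_ge0 // => *; rewrite ?sumr_ge0 // => *.
        by rewrite addr_ge0.
      by rewrite addr_ge0.
    have E s : sgb s * (((term j == v)%:R - (term i == v)%:R) * x ((i, j), None)
        + (\sum_w x ((i, j), Some (v, w)) - \sum_w x ((i, j), Some (w, v)))) <= 0.
      have := xP (inl (inl ((i, j), (v, s)))); rewrite sumJ /=; apply: le_trans.
      rewrite le_eqVlt; apply/orP; left; apply/eqP.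
      under [RHS]eq_bigr => ij' _.
        rewrite (_ : _ + _ = ((i, j) == ij')%:R * (sgb s *
            (((term ij'.2 == v)%:R - (term ij'.1 == v)%:R) * x (ij', None)
             + \sum_a \sum_b ((a == v)%:R - (b == v)%:R) * x (ij', Some (a, b))))); last first.
          rewrite mulrA [RHS]mulrDr; congr (_ + _); first by rewrite !mulrA.
          rewrite mulr_sumr; apply: eq_bigr => a _; rewrite mulr_sumr.
          by apply: eq_bigr => b' _; rewrite !mulrA.
        over.
      rewrite sum1; congr (_ * (_ + _)).
      under [RHS]eq_bigr do under eq_bigr do rewrite mulrBl.
      under [RHS]eq_bigr do rewrite sumrB.
      rewrite sumrB; congr (_ - _).
        under [RHS]eq_bigr do rewrite -mulr_sumr eq_sym.
        by rewrite sum1.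
      rewrite exchange_big /=; under [RHS]eq_bigr do rewrite -mulr_sumr eq_sym.
      by rewrite sum1.
    have := E true; have := E false; rewrite /sgb mul1r mulN1r oppr_le0 => E1 E2.
    have {E1 E2} : ((term j == v)%:R - (term i == v)%:R) * x ((i, j), None)
        + (\sum_w x ((i, j), Some (v, w)) - \sum_w x ((i, j), Some (w, v))) = 0.
      by apply/eqP; rewrite eq_le E1 E2.
    rewrite addrC => /eqP; rewrite addr_eq0 => /eqP ->.
    rewrite [v == term i]eq_sym [v == term j]eq_sym.
    have ne : term i != term j.
      by apply/eqP => /termI e; rewrite e ltnn in ij.
    case: (term i =P v) => [<-|_].
      by rewrite eq_sym (negPf ne) sub0r mulN1r opprK.
    by case: (term j =P v) => _; rewrite subr0 ?mul1r ?mul0r ?oppr0.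
  have := xP (inr tt); rewrite sumJ /= lerNr -sumrN -sumlt; congr (_ <= _).
  apply: eq_bigr => -[i j] _ /=.
  rewrite big1 ?addr0; first by rewrite mulNr opprK mulrAC mulrA.
  by move=> a _; apply: big1 => a' _; rewrite mul0r.
right.
(* The multiplier of the reward row is positive, because capacity costs are nonnegative; dividing by
   it normalises the dual solution. *)
pose z := y (inr tt).
(* The two multipliers of a conservation equation combine into one potential of arbitrary sign. *)
pose ph i j v := y (inl (inl ((i, j), (v, true)))) - y (inl (inl ((i, j), (v, false)))).
pose yc u v := y (inl (inr (u, v))).
have ybE : \sum_u \sum_v yc u v * cap u v < z * Q.
  move: yb; rewrite sumI /= big1 ?add0r; last first.
    by move=> ij _; apply: big1 => v _; rewrite !mulr0 addr0.
  by rewrite mulrN subr_lt0.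
have z_gt0 : 0 < z.
  rewrite lt_def y_ge0 andbT; apply/eqP => z0; move: ybE.
  rewrite z0 mul0r; apply/negP; rewrite -leNgt; apply: sumr_ge0 => u _.
  by apply: sumr_ge0 => v _; rewrite mulr_ge0 ?cap_ge0 ?y_ge0.
have sumph (i j : 'I_k) (h : W -> R) :
    \sum_ij' \sum_v (y (inl (inl (ij', (v, true)))) * ((ij' == (i, j))%:R * sgb true * h v)
      + y (inl (inl (ij', (v, false)))) * ((ij' == (i, j))%:R * sgb false * h v))
    = \sum_v h v * ph i j v.
  under eq_bigr => ij' _.
    under eq_bigr => v _.
      rewrite (_ : _ + _ = ((i, j) == ij')%:R *
         (h v * (y (inl (inl (ij', (v, true)))) - y (inl (inl (ij', (v, false))))))); last first.
        by rewrite eq_sym /sgb; ring.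
      over.
    rewrite -mulr_sumr; over.
  by rewrite sum1.
have colf (i j : 'I_k) u v : (i < j)%N -> ph i j v - ph i j u <= yc u v + yc v u.
  move=> ij; have := yA ((i, j), Some (u, v)).
  rewrite sumI /= sumph mulr0 addr0 /lt ij.
  under [X in _ <= X + _]eq_bigr do rewrite mulrBl.
  rewrite sumrB !sum1.
  under eq_bigr do under eq_bigr do rewrite mul1r mulrC mulrDl.
  under eq_bigr do rewrite big_split.
  rewrite big_split /=.
  under [X in _ + (X + _)]eq_bigr do under eq_bigr do rewrite [u == _]eq_sym [v == _]eq_sym.
  under [X in _ + (_ + X)]eq_bigr do under eq_bigr do
    rewrite [u == _]eq_sym [v == _]eq_sym andbC.
  rewrite !sum2 -/(yc _ _) -/(yc _ _); lra.
have colD (i j : 'I_k) : (i < j)%N -> z * rho i j <= ph i j (term j) - ph i j (term i).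
  move=> ij; have := yA ((i, j), None).
  rewrite sumI /= sumph /lt ij mul1r mulrN -/z.
  under [X in _ <= X + _ + _]eq_bigr do rewrite mulrBl.
  rewrite sumrB !sum1; under [X in _ <= _ + X + _]eq_bigr do under eq_bigr do rewrite mulr0.
  by rewrite [X in _ + X + _]big1 ?addr0 ?subr_ge0 // => u _; rewrite big1.
exists (fun u v => yc u v / z), (fun i j v => ph i j v / z); split.
- by move=> u v; rewrite divr_ge0 ?y_ge0 ?(ltW z_gt0).
- by move=> i j ij u v; rewrite -mulrBl -mulrDl ler_pM2r ?invr_gt0 // colf.
- by move=> i j ij; rewrite -mulrBl ler_pdivlMr // mulrC colD.
- under eq_bigr do under eq_bigr do rewrite mulrAC.
  under eq_bigr do rewrite -mulr_suml.
  by rewrite -mulr_suml ltr_pdivrMr // mulrC.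
Qed.

End FlowDuality.

(** * Weak duality and averaging over the contractions *)

Section Quality.
Variable R : realType.

Section WeakDuality.
Variables (V : finType) (cap : V -> V -> R) (k : nat) (term : 'I_k -> V).
Variables (D : 'I_k -> 'I_k -> R) (f : 'I_k -> 'I_k -> V -> V -> R).
Hypotheses (capC : forall u v, cap u v = cap v u) (cap_ge0 : forall u v, 0 <= cap u v) (termI : injective term).
Hypothesis fD : routes cap term D f.

Lemma load_le_congestion u v : load f u v <= congestion cap f * cap u v.
Proof.
have [cap0|cap_gt0] := leP (cap u v) 0.
  have {}cap0 : cap u v = 0 by apply/eqP; rewrite eq_le cap0 cap_ge0.
  rewrite cap0 mulr0 /load big1 // => i _; apply: big1 => j ij.
  have [_ [fz _]] := fD ij.
  by rewrite !fz ?addr0 // capC.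
rewrite -ler_pdivrMr //.
apply: (@bigmax_sup _ _ _ _ u) => //.
exact: (@bigmax_sup _ _ _ _ v).
Qed.

(** Summation by parts applied to flow conservation. *)
Lemma demand_potential (i j : 'I_k) (phi : V -> R) : (i < j)%N ->
  D i j * (phi (term j) - phi (term i)) = \sum_u \sum_v f i j u v * (phi v - phi u).
Proof.
move=> ij; have [_ [_ cons]] := fD ij.
have ne : term j != term i by apply/eqP => /termI e; rewrite e ltnn in ij.
transitivity (\sum_v - (phi v * (\sum_w f i j v w - \sum_w f i j w v))).
  under eq_bigr do rewrite cons.
  rewrite (bigD1 (term i)) //= (bigD1 (term j)) //= !eqxx (negPf ne).
  rewrite big1 => [|v /andP[/negPf -> /negPf ->]]; last by rewrite mulr0 oppr0.
  by ring.
under eq_bigr do rewrite mulrBr opprB !mulr_sumr.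
rewrite sumrB; under [RHS]eq_bigr do under eq_bigr do rewrite mulrBr.
under [RHS]eq_bigr do rewrite sumrB.
rewrite sumrB [X in X - _]exchange_big /=; congr (_ - _);
  by apply: eq_bigr => u _; apply: eq_bigr => v _; rewrite mulrC.
Qed.

(** Each unit sent from [i] to [j] consumes length at least the gap of [phi i], and the length
    consumed in all is at most the congestion times the total of capacity times length. *)
Lemma weak_duality (l : V -> V -> R) (phi : 'I_k -> V -> R) :
  (forall u v, 0 <= l u v) ->
  (forall i u v, cap u v != 0 -> phi i v - phi i u <= l u v) ->
  \sum_(i : 'I_k) \sum_(j : 'I_k | (i < j)%N)
     D i j * (phi i (term j) - phi i (term i))
  <= congestion cap f * \sum_u \sum_v cap u v * l u v.
Proof.
move=> l_ge0 phi_lip.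
have f_ge0 (i j : 'I_k) u v : (i < j)%N -> 0 <= f i j u v by move/fD => [].
apply: (@le_trans _ _ (\sum_u \sum_v load f u v * l u v)); last first.
  rewrite mulr_sumr; apply: ler_sum => u _; rewrite mulr_sumr.
  by apply: ler_sum => v _; rewrite mulrA ler_wpM2r // load_le_congestion.
apply: (@le_trans _ _ (\sum_(i : 'I_k) \sum_(j : 'I_k | (i < j)%N)
    \sum_u \sum_v (f i j u v + f i j v u) * l u v)).
  apply: ler_sum => i _; apply: ler_sum => j ij; rewrite demand_potential //.
  apply: ler_sum => u _; apply: ler_sum => v _.
  have [cap0|cap0] := eqVneq (cap u v) 0.
    have [_ [fz _]] := fD ij; rewrite fz // mul0r mulr_ge0 ?addr_ge0 ?f_ge0 //.
  rewrite (@le_trans _ _ (f i j u v * l u v)) //.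
    by rewrite ler_wpM2l ?f_ge0 ?phi_lip.
  by rewrite ler_wpM2r // lerDl f_ge0.
rewrite le_eqVlt; apply/orP; left; apply/eqP.
under eq_bigr do rewrite exchange_big /=.
rewrite exchange_big /=; apply: eq_bigr => u _.
under eq_bigr do rewrite exchange_big /=.
rewrite exchange_big /=; apply: eq_bigr => v _.
by rewrite mulr_suml; apply: eq_bigr => i _; rewrite mulr_suml.
Qed.

End WeakDuality.

Section Average.
Variables (V : finType) (cap : V -> V -> R) (k n : nat) (term : 'I_k -> V).
Variables (m : 'I_n -> nat) (p : forall i : 'I_n, V -> 'I_(m i)) (lam : 'I_n -> R).

Lemma Hmu_embed_term i j : valid_partition term (p i) ->
  Hmu_embed term p (p i (term j)) = inl j.
Proof.
move=> [_ pI]; rewrite /Hmu_embed; case: pickP => [j' /eqP/pI -> //|/(_ j)].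
by rewrite eqxx.
Qed.

(** A cost on [Hmu] is the average of the costs on the contracted graphs, where edges inside a part
    vanish. This lets one contraction be singled out. *)
Lemma sum_Hmu_cap (g : Hmu_vertex k m -> Hmu_vertex k m -> R) :
  \sum_x \sum_y g x y * Hmu_cap cap term p lam x y =
  \sum_i lam i * \sum_u \sum_(v | p i u != p i v)
     g (Hmu_embed term p (p i u)) (Hmu_embed term p (p i v)) * cap u v.
Proof.
rewrite /Hmu_cap.
under eq_bigr do under eq_bigr do rewrite mulr_sumr.
under eq_bigr do rewrite exchange_big /=.
rewrite exchange_big /=; apply: eq_bigr => i _.
under eq_bigr do under eq_bigr do rewrite mulrCA.
under eq_bigr do rewrite -mulr_sumr.
rewrite -mulr_sumr; congr (_ * _).
pose e a := Hmu_embed term p (i := i) a.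
transitivity (\sum_x \sum_(a | e a == x) \sum_y \sum_(b | e b == y)
    g (e a) (e b) * contract_cap cap (p i) a b).
  apply: eq_bigr => x _; rewrite exchange_big /=; apply: eq_bigr => y _.
  rewrite mulr_sumr; apply: eq_bigr => a /eqP ea; rewrite mulr_sumr.
  by apply: eq_bigr => b /eqP eb; rewrite -ea -eb.
have sume (F : 'I_(m i) -> R) : \sum_x \sum_(a | e a == x) F a = \sum_a F a.
  by rewrite [RHS](partition_big e xpredT).
rewrite sume; transitivity (\sum_a \sum_b g (e a) (e b) * contract_cap cap (p i) a b).
  by apply: eq_bigr => a _; exact: sume.
apply/esym; rewrite (partition_big (p i) xpredT) //=; apply: eq_bigr => a _.
rewrite (exchange_big_dep predT) //= (partition_big (p i) xpredT) //=.
apply: eq_bigr => b _; rewrite /contract_cap.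
have [<-|ne] := eqVneq a b.
  rewrite mulr0 big1 // => v /eqP pv; rewrite big1 // => u /andP[/eqP -> /eqP].
  by rewrite pv.
rewrite exchange_big mulr_sumr; apply: eq_bigr => v /eqP pv.
rewrite mulr_sumr /=; apply: eq_big => [u|u /andP[/eqP pu _]]; last by rewrite pu pv.
by rewrite pv; case: eqP => // ->; rewrite ne.
Qed.

End Average.
End Quality.

Section SparsifierDual.
Variable R : realType.

Lemma congestion_le1 (W : finType) (cap : W -> W -> R) (k : nat)
    (f : 'I_k -> 'I_k -> W -> W -> R) :
  (forall u v, load f u v <= cap u v) -> congestion cap f <= 1.
Proof.
move=> fle; apply: bigmax_le => // u _; apply: bigmax_le => // v cap_gt0.
by rewrite ler_pdivrMr // mul1r.
Qed.

(** Duality is applied in [Hmu] with the gaps of [phi] as rewards and [q0 * vol] as target. A demand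
    reaching the target with congestion at most 1 in [Hmu] would have congestion at most [q < q0] in
    the original graph, while weak duality there asks for at least [q0]. So the dual solution
    exists. *)
Lemma sparsifier_dual (V : finType) (cap : V -> V -> R) (k n : nat)
    (term : 'I_k -> V) (m : 'I_n -> nat) (p : forall i : 'I_n, V -> 'I_(m i))
    (lam : 'I_n -> R) (q q0 : R) (l : V -> V -> R) (phi : 'I_k -> V -> R) :
  sym_cap cap -> injective term -> convex_comb term p lam ->
  flow_sparsifier cap (Hmu_cap cap term p lam) term (Hmu_term m) q ->
  (forall u v, 0 <= l u v) ->
  (forall i u v, cap u v != 0 -> phi i v - phi i u <= l u v) ->
  0 < \sum_u \sum_v cap u v * l u v -> q < q0 ->
  exists i (y : 'I_(m i) -> 'I_(m i) -> R) (psi : 'I_k -> 'I_k -> 'I_(m i) -> R),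
   [/\ forall a b, 0 <= y a b,
     forall i' j : 'I_k, (i' < j)%N ->
       forall a b, psi i' j b - psi i' j a <= y a b + y b a,
     forall i' j : 'I_k, (i' < j)%N ->
       phi i' (term j) - phi i' (term i') <=
         psi i' j (p i (term j)) - psi i' j (p i (term i'))
   & \sum_u \sum_(v | p i u != p i v) y (p i u) (p i v) * cap u v
       < q0 * \sum_u \sum_v cap u v * l u v].
Proof.
move=> [capC [cap_ge0 _]] termI [lam_gt0 [lam1 pV]] [q_ge1 qP] l_ge0 phi_lip.
set vol := \sum_u \sum_v cap u v * l u v => vol_gt0 qq0.
have q_gt0 : 0 < q by apply: lt_le_trans q_ge1.
have q0_gt0 : 0 < q0 by apply: lt_trans qq0.
have H_ge0 u v : 0 <= Hmu_cap cap term p lam u v.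
  apply: sumr_ge0 => i _; rewrite mulr_ge0 ?(ltW (lam_gt0 i)) //.
  apply: sumr_ge0 => a _; apply: sumr_ge0 => b _; rewrite /contract_cap.
  by case: ifP => // _; apply: sumr_ge0 => ? _; apply: sumr_ge0.
pose rho (i j : 'I_k) := phi i (term j) - phi i (term i).
have HI : injective (@Hmu_term k n m) by move=> i j [].
have [[D [f [D_ge0 fD floads Drho]]]|[y [ps [y_ge0 psy psrho ycap]]]] :=
    flow_duality rho (q0 * vol) H_ge0 HI.
  have dD : demand D.
    split=> [i j _|]; first exact: D_ge0.
    apply: contrapT => nD; have := lt_le_trans (mulr_gt0 q0_gt0 vol_gt0) Drho.
    rewrite big1 ?ltxx // => i _; apply: big1 => j ij.
    suff -> : D i j = 0 by rewrite mul0r.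
    apply/eqP; rewrite eq_le D_ge0 andbT leNgt; apply/negP => Dij.
    by apply: nD; exists i, j.
  have [_ congG] := qP _ dD.
  have congH : (cong (Hmu_cap cap term p lam) (Hmu_term m) D <= 1%:E)%E.
    apply: (@le_trans _ _ (congestion (Hmu_cap cap term p lam) f)%:E).
      by apply: ereal_inf_lbound; exists f.
    by rewrite lee_fin congestion_le1.
  have : (cong cap term D < q0%:E)%E.
    apply: (le_lt_trans congG); apply: (@le_lt_trans _ _ (q%:E * 1%:E)%E).
      by rewrite lee_wpmul2l // lee_fin ltW.
    by rewrite mule1 lte_fin.
  move=> /ereal_inf_lt [_ [g gD <-]]; rewrite lte_fin => cg.
  have := weak_duality capC cap_ge0 termI gD l_ge0 phi_lip.
  rewrite -/vol => /(le_trans Drho); rewrite ler_pM2r // => /(lt_le_trans cg).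
  by rewrite ltxx.
(* The dual cost on [Hmu] is an average with weights [lam], so some contraction costs less than
   [q0 * vol]. *)
have [i yi] : exists i, \sum_u \sum_(v | p i u != p i v)
   y (Hmu_embed term p (p i u)) (Hmu_embed term p (p i v)) * cap u v < q0 * vol.
  apply: contrapT => ny; move: ycap; rewrite sum_Hmu_cap; apply/negP.
  rewrite -leNgt -[X in X <= _]mul1r -lam1 mulr_suml; apply: ler_sum => i _.
  rewrite ler_wpM2l ?(ltW (lam_gt0 i)) // leNgt; apply/negP => yi.
  by apply: ny; exists i.
exists i, (fun a b => y (Hmu_embed term p a) (Hmu_embed term p b)).
exists (fun i' j a => ps i' j (Hmu_embed term p a)); split=> // [*|i' j ij].
  exact: psy.
by rewrite !Hmu_embed_term //; exact: psrho.
Qed.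

End SparsifierDual.

(** * The lower bound *)

Section CellCapacity.
Variables (R : realType) (k M d L : nat) (pi : {ffun 'I_d -> {perm 'I_k * 'I_M}}).
Local Notation U := ('I_k * 'I_M)%type.
Local Notation V := ('I_k + U)%type.

Definition perm_mult (u v : U) : nat := #|[pred c | pi c u == v]|.

(** Capacity [L] on permutation edges of length 1 balances capacity 1 on cell edges of length [L]:
    every edge has volume [L]. Fixed points of the permutations give no edge. *)
Definition cell_cap (x y : V) : R := match x, y with
  | inl _, inl _ => 0
  | inl i, inr u | inr u, inl i => (u.1 == i)%:R
  | inr u, inr v => if u == v then 0 else (L * (perm_mult u v + perm_mult v u))%:R
  end.

Definition cell_len (x y : V) : R := match x, y with
  | inl _, inl _ => 0
  | inl _, inr _ | inr _, inl _ => L%:R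
  | inr u, inr v => (u != v)%:R
  end.

Lemma cell_cap_sym : sym_cap cell_cap.
Proof.
split; last split=> [[i|u] [j|v]|[i|u]] //=; rewrite ?eqxx ?ler0n //.
  by move=> [i|u] [j|v] //=; rewrite eq_sym addnC.
by case: ifP => // _; exact: ler0n.
Qed.

Lemma cell_cap_ge1 x y : cell_cap x y != 0 -> 1 <= cell_cap x y.
Proof.
by case: x y => [i|u] [j|v] //=; try case: ifP => _; rewrite ?eqxx // pnatr_eq0 ler1n lt0n.
Qed.

Lemma cell_len_ge0 x y : 0 <= cell_len x y.
Proof. by case: x y => [i|u] [j|v] /=; rewrite ?ler0n. Qed.

Lemma perm_multE u v : (perm_mult u v)%:R = \sum_c (pi c u == v)%:R :> R.
Proof. by rewrite /perm_mult -sum1_card natr_sum big_mkcond; apply: eq_bigr => c _; rewrite inE; case: eqP. Qed.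

(** Fixed points of the permutations appear on the right only; the vanishing of [g] on the diagonal
    reconciles the two sides. *)
Lemma sum_cell_cap (g : V -> V -> R) : (forall x, g x x = 0) ->
  \sum_x \sum_y g x y * cell_cap x y =
  \sum_u (g (inl u.1) (inr u) + g (inr u) (inl u.1)) +
  L%:R * \sum_(x : 'I_d * U)
     (g (inr x.2) (inr (pi x.1 x.2)) + g (inr (pi x.1 x.2)) (inr x.2)).
Proof.
move=> g0; rewrite big_sumType /=.
under eq_bigr => i _.
  rewrite big_sumType /= big1 ?add0r; last by move=> j _; rewrite mulr0.
  over.
under [X in _ + X = _]eq_bigr do rewrite big_sumType /=.
rewrite exchange_big big_split /= addrA; congr (_ + _).
  rewrite -big_split; apply: eq_bigr => u _ /=.
  by congr (_ + _); rewrite (bigD1 u.1) //= eqxx mulr1 big1 ?addr0 // => i ne;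
    rewrite eq_sym (negPf ne) mulr0.
transitivity (L%:R * \sum_u \sum_v \sum_c
    (g (inr u) (inr v) * (pi c u == v)%:R + g (inr u) (inr v) * (pi c v == u)%:R)).
  rewrite mulr_sumr; apply: eq_bigr => u _.
  rewrite mulr_sumr; apply: eq_bigr => v _.
  have [->|ne] := eqVneq u v.
    by rewrite mulr0 big1 ?mulr0 // => c _; rewrite g0 !mul0r addr0.
  by rewrite natrM natrD !perm_multE big_split /= -!mulr_sumr -mulrDr mulrCA.
congr (_ * _).
transitivity (\sum_u (\sum_v \sum_c g (inr u) (inr v) * (pi c u == v)%:R
    + \sum_v \sum_c g (inr u) (inr v) * (pi c v == u)%:R)).
  apply: eq_bigr => u _; rewrite -big_split; apply: eq_bigr => v _.
  exact: big_split.
have pairsum (h : 'I_d -> U -> R) : \sum_(x : 'I_d * U) h x.1 x.2 = \sum_u \sum_c h c u.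
  by rewrite -(pair_bigA _ h) exchange_big.
rewrite !big_split /=; congr (_ + _).
  rewrite (pairsum (fun c u => g (inr u) (inr (pi c u)))); apply: eq_bigr => u _; rewrite exchange_big; apply: eq_bigr => c _.
  rewrite (bigD1 (pi c u)) //= eqxx mulr1 big1 ?addr0 // => v ne.
  by rewrite eq_sym (negPf ne) mulr0.
rewrite exchange_big (pairsum (fun c u => g (inr (pi c u)) (inr u))) /=.
apply: eq_bigr => v _; rewrite exchange_big; apply: eq_bigr => c _.
rewrite (bigD1 (pi c v)) //= eqxx mulr1 big1 ?addr0 // => u ne.
by rewrite eq_sym (negPf ne) mulr0.
Qed.

Lemma cell_vol_le :
  \sum_x \sum_y cell_cap x y * cell_len x y <= ((2 * d).+2 * (k * M) * L)%:R.
Proof.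
under eq_bigr do under eq_bigr do rewrite mulrC.
rewrite sum_cell_cap => [|[i|u]] //=; last by rewrite eqxx.
apply: (@le_trans _ _ ((L * 2 * (k * M))%:R + L%:R * (d * (k * M) * 2)%:R)).
  apply: lerD; last apply: ler_wpM2l => //.
    by rewrite sumr_const card_prod !card_ord -natrD -mulrnA addnn -muln2.
  apply: (@le_trans _ _ (\sum_(x : 'I_d * U) 2%:R)).
    by apply: ler_sum => x _; rewrite -natrD ler_nat; do 2!case: (_ != _).
  by rewrite sumr_const !card_prod !card_ord -mulrnA mulnC.
by rewrite -natrM -natrD ler_nat; lia.
Qed.

Lemma cell_vol_gt0 : (0 < k)%N -> (0 < M)%N -> (0 < L)%N ->
  0 < \sum_x \sum_y cell_cap x y * cell_len x y.
Proof.
move=> k0 M0 L0; under eq_bigr do under eq_bigr do rewrite mulrC.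
rewrite sum_cell_cap => [|[i|u]] //=; last by rewrite eqxx.
apply: ltr_wpDr.
  rewrite mulr_ge0 //; apply: sumr_ge0 => x _; by rewrite addr_ge0.
by rewrite sumr_const card_prod !card_ord -natrD -mulrnA ltr0n !muln_gt0 addn_gt0 L0 k0 M0.
Qed.

End CellCapacity.

(** * Quality bound from well-chosen permutations *)

Section CellGraphQuality.
Variable R : realType.

Lemma path_potential (W : finType) (Y : W -> W -> R) (psi : W -> R) (B : R) r c s :
  (forall a b, Y a b = Y b a) -> (forall a b, psi b - psi a <= Y a b) -> 0 <= B ->
  path (fun a b => Y a b <= B) c s -> (size s <= r)%N ->
  psi (last c s) - psi c <= r%:R * B /\ psi c - psi (last c s) <= r%:R * B.
Proof.
move=> YC psiY B_ge0 cs sr.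
suff [le1 le2] : psi (last c s) - psi c <= (size s)%:R * B /\
    psi c - psi (last c s) <= (size s)%:R * B.
  have le : (size s)%:R * B <= r%:R * B by rewrite ler_wpM2r // ler_nat.
  by split; [apply: le_trans le1 le|apply: le_trans le2 le].
elim: s c cs {sr} => [|a s IHs] c /=; first by rewrite subrr mul0r.
move=> /andP[ca /IHs[le1 le2]]; rewrite -addn1 natrD mulrDl mul1r.
have := le_trans (psiY c a) ca; have : psi c - psi a <= B.
  by apply: le_trans ca; rewrite YC.
by move=> ? ?; split; lra.
Qed.

Lemma markov_count (T : finType) (g : T -> R) (A S : R) :
  (forall x, 0 <= g x) -> \sum_x g x <= S -> #|[pred x | A < g x]|%:R * A <= S.
Proof.
move=> g_ge0; apply: le_trans; rewrite mulr_natl -sumr_const big_mkcond /=.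
by apply: ler_sum => x _; rewrite inE; case: ifP => // /ltW.
Qed.

(** Were [q < q0], some contraction would have cheap edge lengths, so that most permutation edges
    would be short between good vertices, against the hypothesis on [pi]. The threshold [A] is eight
    times the budget per vertex and unit of [L]. *)
Lemma perms_quality (k M d L D b r : nat) (pi : {ffun 'I_d -> {perm 'I_k * 'I_M}}) (q0 : R) :
  (0 < k)%N -> (0 < M)%N -> (1 < d)%N -> (0 < L)%N -> 0 < q0 ->
  (forall (W : finType) (F : 'I_k * 'I_M -> W) (short : rel W) (good : {set 'I_k * 'I_M}),
    symmetric short -> (b * #|W| <= k * M)%N -> (#|W| < b ^ r.+1)%N ->
    (forall u v, u \in good -> v \in good ->
      (exists c s s', [/\ path short c s, last c s = F u, (size s <= r.+1)%N &
                      [/\ path short c s', last c s' = F v & (size s' <= r.+1)%N]]) ->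
      reach (perm_edge pi) (@cell_edge k M) L (inl u.1) D (inl v.1)) ->
    (2 * #|[set x : 'I_d * ('I_k * 'I_M) | [&& x.2 \in good, pi x.1 x.2 \in good
                               & short (F x.2) (F (pi x.1 x.2))]]%SET| < d * (k * M))%N) ->
  let A := 8%:R * ((2 * d).+2)%:R * q0 in
  2%:R * (A * L%:R) + 2%:R * (r.+1%:R * A) < D%:R ->
  forall (n : nat) (m : 'I_n -> nat) (p : forall i : 'I_n, 'I_k + 'I_k * 'I_M -> 'I_(m i))
         (lam : 'I_n -> R),
    convex_comb (fun i => inl i) p lam ->
    (forall i, (b * m i <= k * M)%N) -> (forall i, (m i < b ^ r.+1)%N) ->
    forall q, flow_sparsifier (cell_cap R L pi) (Hmu_cap (cell_cap R L pi) (fun i => inl i) p lam)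
      (fun i => inl i) (Hmu_term m) q ->
    q0 <= q.
Proof.
move=> k_gt0 M_gt0 d_gt1 L_gt0 q0_gt0 Hpi A HD n m p lam pc bm mb q qP.
have A_gt0 : 0 < A by rewrite /A !mulr_gt0 // ltr0n.
(* The dual potentials on the cell graph: truncated distances from the terminals, 1-Lipschitz for
   [cell_len] along edges. *)
pose ds i x := dist (perm_edge pi) (@cell_edge k M) L D (inl i) x.
rewrite leNgt; apply/negP => qq0.
have lip i u v : cell_cap R L pi u v != 0 ->
    (ds i v)%:R - (ds i u)%:R <= cell_len R L u v.
  rewrite lerBlDl; case: u v => [i'|u] [j|v] /=.
  - by rewrite eqxx.
  - rewrite pnatr_eq0 eqb0 negbK => uv; rewrite -natrD ler_nat.
    by apply: dist_step => l rl; apply: reach2 rl _.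
  - rewrite pnatr_eq0 eqb0 negbK => uv; rewrite -natrD ler_nat.
    by apply: dist_step => l rl; apply: reach2 rl _.
  - have [_|_] := eqVneq u v; first by rewrite eqxx.
    rewrite pnatr_eq0 muln_eq0 addn_eq0 !negb_or negb_and => /andP[_ mu].
    rewrite -natrD ler_nat addn1; apply: leq_trans (_ : _ <= ds i (inr u) + 1)%N _; last by rewrite addn1.
    apply: dist_step => l rl; rewrite addn1; apply: reach1 rl _ => /=.
    case/orP: mu; rewrite -lt0n => /card_gt0P[c]; rewrite inE => e;
      by apply/existsP; exists c; rewrite e ?orbT.
have termI : injective (fun i : 'I_k => inl i : 'I_k + 'I_k * 'I_M) by move=> ? ? [].
have [i [y [psi [y_ge0 psiy psirho ysum]]]] :=
  sparsifier_dual (cell_cap_sym R L pi) termI pc qP (@cell_len_ge0 R k M L) lip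
    (cell_vol_gt0 R pi k_gt0 M_gt0 L_gt0) qq0.
set f := p i in psirho ysum.
(* Symmetrised dual lengths, zero on the diagonal so that edges inside a part cost nothing. *)
pose Y a c := if a == c then 0 else y a c + y c a.
have YC a c : Y a c = Y c a by rewrite /Y eq_sym addrC.
have Y_ge0 a c : 0 <= Y a c by rewrite /Y; case: ifP => // _; rewrite addr_ge0.
have psiY (i' j : 'I_k) a c : (i' < j)%N -> psi i' j c - psi i' j a <= Y a c.
  by move=> ij; rewrite /Y; case: eqP => [->|_]; [rewrite subrr|exact: psiy].
pose Q := ((2 * d).+2 * (k * M) * L)%:R * q0.
have [S1 S2] : \sum_u Y (f (inl u.1)) (f (inr u)) <= Q /\
    L%:R * \sum_(x : 'I_d * ('I_k * 'I_M)) Y (f (inr x.2)) (f (inr (pi x.1 x.2))) <= Q.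
  pose g u v := if f u == f v then 0 else y (f u) (f v).
  have Yg u v : g u v + g v u = Y (f u) (f v).
    by rewrite /g /Y eq_sym; case: ifP; rewrite ?addr0.
  have g_ge0 u v : 0 <= g u v by rewrite /g; case: ifP.
  have g0 u : g u u = 0 by rewrite /g eqxx.
  have := sum_cell_cap L pi g0; set T := (X in X = _) => Tsum.
  have TQ : T <= Q.
    apply: (@le_trans _ _ (q0 * \sum_x \sum_y cell_cap R L pi x y * cell_len R L x y));
      last by rewrite mulrC ler_wpM2r ?(ltW q0_gt0) // cell_vol_le.
    apply: le_trans (ltW ysum); rewrite /T le_eqVlt; apply/orP; left; apply/eqP.
    apply: eq_bigr => u _; rewrite [RHS]big_mkcond; apply: eq_bigr => v _ /=.
    by rewrite /g; case: eqP => //= _; rewrite mul0r.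
  have E1 : \sum_u (g (inl u.1) (inr u) + g (inr u) (inl u.1)) =
      \sum_u Y (f (inl u.1)) (f (inr u)) by apply: eq_bigr => u _; exact: Yg.
  have E2 : \sum_(x : 'I_d * ('I_k * 'I_M))
      (g (inr x.2) (inr (pi x.1 x.2)) + g (inr (pi x.1 x.2)) (inr x.2)) =
      \sum_(x : 'I_d * ('I_k * 'I_M)) Y (f (inr x.2)) (f (inr (pi x.1 x.2))).
    by apply: eq_bigr => x _; exact: Yg.
  rewrite Tsum E1 E2 in TQ; split; apply: le_trans TQ.
    by rewrite lerDl mulr_ge0 // sumr_ge0.
  by rewrite lerDr sumr_ge0.
(* By Markov's inequality, most vertices are good and most permutation edges are
   short. *)
pose good := [set u | Y (f (inl u.1)) (f (inr u)) <= A * L%:R]%SET.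
pose short a c := Y a c <= A.
(* Going from terminal [u.1] through [u], [c] and [v] to terminal [v.1] raises [psi] by at most
   [2 * A * L + 2 * r.+1 * A], which is less than [D]; a truncated distance below [D] is realised by
   a walk. *)
have near u v : u \in good -> v \in good -> (u.1 < v.1)%N ->
      (exists c s s', [/\ path short c s, last c s = f (inr u), (size s <= r.+1)%N &
                      [/\ path short c s', last c s' = f (inr v) & (size s' <= r.+1)%N]]) ->
      reach (perm_edge pi) (@cell_edge k M) L (inl u.1) D (inl v.1).
  rewrite !inE => ug vg uv [c [s [s' [ps ls ss [ps' ls' ss']]]]].
  have [_ le1] := path_potential YC (fun a b => psiY _ _ a b uv) (ltW A_gt0) ps ss.
  have [le2 _] := path_potential YC (fun a b => psiY _ _ a b uv) (ltW A_gt0) ps' ss'.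
  have := psirho _ _ uv; rewrite /ds distxx subr0 => le3.
  have le4 := psiY _ _ (f (inl u.1)) (f (inr u)) uv.
  have := psiY _ _ (f (inr v)) (f (inl v.1)) uv; rewrite YC => le5.
  apply: reach_leq (dist_lt _) => //; last first.
    rewrite -(ltr_nat R); rewrite ls in le1; rewrite ls' in le2; lra.
  by apply: ltnW; rewrite -(ltr_nat R); rewrite ls in le1; rewrite ls' in le2; lra.
have shortC : symmetric short by move=> a c; rewrite /short YC.
have := Hpi _ (fun u => f (inr u)) short good shortC; rewrite card_ord.
move=> /(_ (bm i) (mb i)); set S := [set x | _]%SET => few.
have {few} : (2 * #|S| < d * (k * M))%N.
  apply: few => u v ug vg [c [s [s' [ps ls ss ps']]]].
  have [uv|vu|uv] := ltngtP u.1 v.1.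
  - by apply: (near u v ug vg uv); exists c, s, s'.
  - apply: reach_sym; [exact: perm_edgeC|exact: cell_edgeC|].
    by apply: (near v u vg ug vu); case: ps' => ? ? ?; exists c, s', s.
  - by have -> : u.1 = v.1 by [apply: val_inj]; apply: reach_leq (reach0 _ _ _ _).
apply/negP; rewrite -leqNgt.
pose bad1 := #|~: good|%SET.
pose bad2 := #|[pred x : 'I_d * ('I_k * 'I_M) | A < Y (f (inr x.2)) (f (inr (pi x.1 x.2)))]|.
have AL_gt0 : 0 < A * L%:R by rewrite mulr_gt0 ?ltr0n.
have QE : Q * 8%:R = (k * M)%:R * (A * L%:R) by rewrite /Q /A !natrM; ring.
have bad1_le : (8 * bad1 <= k * M)%N.
  rewrite -(ler_nat R) -(ler_pM2r AL_gt0) -QE natrM -mulrA mulrC ler_pM2r ?ltr0n //.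
  apply: le_trans (markov_count (A * L%:R) _ S1) => //; rewrite ler_wpM2r ?(ltW AL_gt0) //.
  rewrite ler_nat; apply: eq_leq; apply: eq_card => u.
  by rewrite !inE ltNge.
have bad2_le : (8 * bad2 <= k * M)%N.
  rewrite -(ler_nat R) -(ler_pM2r AL_gt0) -QE natrM -mulrA mulrC ler_pM2r ?ltr0n //.
  apply: le_trans S2; rewrite mulrA mulrC ler_wpM2l //.
  exact: (markov_count A).
(* A pair outside [S] has a bad end or a long edge. With both bad counts at most an eighth of
   [k * M] and [d >= 2], such pairs are less than half of all. *)
have cover : (d * (k * M) <= #|S| + (d * bad1 + d * bad1 + bad2))%N.
  have cX : #|{: 'I_d * ('I_k * 'I_M)}| = (d * (k * M))%N by rewrite !card_prod !card_ord.
  pose B1 := [set x : 'I_d * ('I_k * 'I_M) | x.2 \notin good]%SET.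
  pose B2 := [set x : 'I_d * ('I_k * 'I_M) | pi x.1 x.2 \notin good]%SET.
  pose B3 := [set x : 'I_d * ('I_k * 'I_M) | A < Y (f (inr x.2)) (f (inr (pi x.1 x.2)))]%SET.
  have cB : #|finset.setX [set: 'I_d]%SET (~: good)%SET| = (d * bad1)%N.
    by rewrite cardsX cardsT card_ord.
  have c1 : (#|B1| <= d * bad1)%N.
    rewrite -cB; apply: subset_leq_card; apply/fintype.subsetP => x.
    by rewrite !inE.
  (* Permutations are injective, so bad heads are as few as bad tails. *)
  have c2 : (#|B2| <= d * bad1)%N.
    pose h (x : 'I_d * ('I_k * 'I_M)) := (x.1, pi x.1 x.2).
    have hI : injective h by move=> [c u] [c' u'] [/= <- /perm_inj <-].
    rewrite -cB -(card_imset _ hI); apply: subset_leq_card.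
    by apply/fintype.subsetP => _ /imsetP[x + ->]; rewrite !inE.
  have c3 : (#|B3| <= bad2)%N.
    by apply: eq_leq; apply: eq_card => x; rewrite !inE.
  have -> : (d * (k * M))%N = #|S :|: (B1 :|: B2 :|: B3)|%SET.
    rewrite -cX -cardsT; congr (#|pred_of_set _|); apply/finset.setP => x; rewrite !inE /short.
    by rewrite ltNge; do 3!case: (_ <= _).
  apply: leq_trans (leq_card_setU _ _) _; rewrite leq_add2l.
  apply: leq_trans (leq_card_setU _ _) _; apply: leq_add c3.
  by apply: leq_trans (leq_card_setU _ _) _; apply: leq_add.
have bad1_le' : (8 * (d * bad1) <= d * (k * M))%N by rewrite mulnCA leq_mul2l bad1_le orbT.
have : (k * M <= d * (k * M))%N by rewrite leq_pmull // ltnW.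
by clear -cover bad1_le' bad2_le; lia.
Qed.

End CellGraphQuality.

(** * Choice of parameters *)

Section ParameterChoice.
Variable R : realType.

(** Here [b = 2 ^ sig] and [M = b ^ 2], so [k * 2 ^ sig] clusters are exactly [k * M / b]. Further
    [d = 64], [C = 2 * 64 + 2 = 130], [L = 2 * sig + 1], [D = kap %/ 16], and [r] is such that
    [b ^ r.+1] exceeds the number of clusters. *)
Lemma cell_graph_quality (k kap sig : nat) (q0 : R) :
  (2 ^ kap <= k)%N -> (k < 2 ^ kap.+1)%N -> (0 < sig)%N -> (2 * sig <= kap)%N ->
  (31 <= kap)%N -> 0 < q0 ->
  16%:R * 130%:R * q0 * ((2 * sig).+1 + (kap %/ sig).+2)%:R < (kap %/ 16)%:R ->
  exists (V : finType) (cap : V -> V -> R) (term : 'I_k -> V),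
    sym_cap cap /\ (forall u v, cap u v != 0 -> 1 <= cap u v) /\ injective term /\
    forall (n : nat) (m : 'I_n -> nat) (p : forall i : 'I_n, V -> 'I_(m i)) (lam : 'I_n -> R),
      convex_comb term p lam -> (forall i, (m i <= k * 2 ^ sig)%N) ->
      forall q, flow_sparsifier cap (Hmu_cap cap term p lam) term (Hmu_term m) q ->
      q0 <= q.
Proof.
move=> kap_le kap_gt sig_gt0 sig_le kap31 q0_gt0 num.
have k_gt0 : (0 < k)%N by apply: leq_trans kap_le; rewrite expn_gt0.
pose M := (2 ^ (2 * sig))%N; pose r := (kap %/ sig).+1.
have M_gt0 : (0 < M)%N by rewrite expn_gt0.
have pow2 a c : (a <= c)%N -> (2 ^ a <= 2 ^ c)%N by rewrite leq_exp2l.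
have [|||||||||| pi piP] := @perms_avoid_covers k M 64 (2 * sig).+1 (kap %/ 16) 130 (2 ^ sig) r
    (2 ^ (kap %/ 4)) => //; rewrite ?expn_gt0 //.
- by rewrite /= /M leq_exp2r ?muln_gt0.
(* As [130 <= 2 ^ 8], the two factors have exponents of at most [kap / 2] each. *)
- apply: leq_trans kap_le; apply: (@leq_trans (2 ^ (8 * (kap %/ 16)) * 2 ^ (kap %/ 4 * 2))).
    rewrite -expnM leq_mul2r [X in (_ <= X)%N]expnM; apply/orP; right.
    by case: (kap %/ 16)%N => // D'; rewrite leq_exp2r.
  by rewrite -expnD; apply: pow2; lia.
(* With [2 * sig <= kap] this exponent is at most [8 * kap + 197], which is below
   [16 * kap - 48 <= 64 * (kap %/ 4)] once [kap >= 31]. *)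
- apply: (@leq_ltn_trans (2 ^ (1 + (kap.+1 + 2 * sig) * 4 + 192))).
    rewrite !expnD (_ : (8 ^ 64 = 2 ^ 192)%N); last by rewrite -[8%N]/(2 ^ 3)%N -expnM.
    rewrite leq_mul2r leq_mul2l; apply/orP; right; apply/orP; right.
    rewrite expnM leq_exp2r // expnD leq_mul2r; apply/orP; right; exact: ltnW.
  by rewrite -expnM ltn_exp2l //; lia.
exists _, (cell_cap R (2 * sig).+1 pi), (fun i => inl i).
split; first exact: cell_cap_sym.
split; first exact: cell_cap_ge1.
split; first by move=> ? ? [].
move=> n m p lam pc mle q; apply: (perms_quality _ _ _ _ _ piP _ pc) => //.
- by apply: le_lt_trans num; rewrite natrD /r; lra.
- move=> i; apply: leq_trans (leq_mul (leqnn _) (mle i)) _.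
  by rewrite mulnCA -expnD addnn -mul2n.
- move=> i; apply: leq_ltn_trans (mle i) _.
  apply: (@leq_trans (2 ^ kap.+1 * 2 ^ sig)); first by rewrite ltn_mul2r expn_gt0.
  rewrite -expnD -expnM; apply: pow2; rewrite /r.
  have := divn_eq kap sig; have := ltn_pmod kap sig_gt0; nia.
Qed.

Lemma c0_gt0 : 0 < c0 R.
Proof.
by rewrite /c0 /log2 divr_gt0 // addr_gt0 // divr_gt0 // ln_gt0 // ltr1n.
Qed.

(** Follows from [log2 5 >= 1]. It makes the cover radius, about [kap / sig], no larger than the
    order of [sig]. *)
Lemma c0_le_half : c0 R <= 2^-1.
Proof.
have ln2 : 0 < ln (2 : R) by rewrite ln_gt0 // ltr1n.
rewrite /c0 /log2 div1r lef_pV2 ?posrE; last 2 first.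
- by rewrite addr_gt0 // divr_gt0 // ln_gt0 // ltr1n.
- by [].
have : 1 <= ln (5 : R) / ln 2 by rewrite ler_pdivlMr // mul1r ler_ln ?posrE // ler_nat.
lra.
Qed.

End ParameterChoice.

Theorem theorem1p1 (R : realType) :
  exists C : R, 0 < C /\
  exists eps0 : R, 0 < eps0 /\
  forall eps : R, 0 < eps -> eps < eps0 ->
  exists k0 : nat, forall k : nat, (k0 <= k)%N ->
    exists (V : finType) (cap : V -> V -> R) (term : 'I_k -> V),
      sym_cap cap /\ (forall u v, cap u v != 0 -> 1 <= cap u v) /\
      injective term /\
      forall (n : nat) (m : 'I_n -> nat) (p : forall i : 'I_n, V -> 'I_(m i))
             (lam : 'I_n -> R),
        convex_comb term p lam ->
        (forall i, (m i)%:R <= k%:R *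
            powR 2 (powR (log2 k%:R) ((1 - c0 R) + eps))) ->
        forall q : R,
          flow_sparsifier cap (Hmu_cap cap term p lam) term (Hmu_term m) q ->
          powR (log2 k%:R) (c0 R - C * eps) <= q.
Proof.
(* With the constant 2, [q0 * X] below is [K ^ (1 - eps)], leaving a factor [K ^ eps] to absorb
   constants; [eps < c0 / 2] keeps the exponent of [q0] positive. *)
exists 2; split=> //; exists (c0 R / 2); split; first by rewrite divr_gt0 ?c0_gt0.
move=> eps eps_gt0 eps_lt; have c0h := c0_le_half R; have c0p := c0_gt0 R.
(* Nearly four times [16 * 130 * 8 * 16], the constant of the final comparison; the margin covers
   the rounding in [kap] and [kap %/ 16]. *)
have [T [T_gt0 TE]] : exists T : R, 0 < T /\ T = 64 * 64 * 64 * 4.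
  by exists (64 * 64 * 64 * 4); split; [rewrite !mulr_gt0 ?ltr0n|].
pose B := Num.max 64 (powR T eps^-1).
exists (Num.truncn (powR 2 B)).+1 => k kB.
have ln2 : 0 < ln (2 : R) by rewrite ln_gt0 // ltr1n.
have kB' : powR 2 B <= k%:R.
  have /truncn_itv/andP[_ /ltW lt] : 0 <= powR 2 B by exact: powR_ge0.
  by apply: le_trans lt _; rewrite ler_nat.
have k_gt0 : 0 < k%:R :> R by apply: lt_le_trans kB'; rewrite powR_gt0.
set K := log2 k%:R.
have KB : B <= K.
  by rewrite /K /log2 ler_pdivlMr // -ln_powR ler_ln ?posrE // powR_gt0.
have K64 : 64 <= K by apply: le_trans KB; rewrite le_max lexx.
have K_gt0 : 0 < K by lra.
have K1 : 1 <= K by lra.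
have KT : T <= powR K eps.
  rewrite -[T]powRr1; last exact: ltW.
  rewrite -(mulVf (lt0r_neq0 eps_gt0)) powRrM ge0_ler_powR ?nnegrE ?powR_ge0 ?(ltW eps_gt0) //.
    exact: ltW.
  by apply: le_trans KB; rewrite le_max lexx orbT.
pose q0 := powR K (c0 R - 2 * eps).
have q0_ge1 : 1 <= q0.
  rewrite -(powRr0 K); apply: ler_powR => //; lra.
set X := powR K (1 - c0 R + eps).
have X_ge1 : 1 <= X by rewrite -(powRr0 K); apply: ler_powR => //; lra.
have KX : K <= X * X.
  rewrite /X -powRD; last by apply/implyP => _; rewrite gt_eqF.
  (* The exponent [2 * (1 - c0 + eps)] is at least 1 because [c0 <= 1 / 2]. *)
  rewrite -[leLHS]powRr1 ?(ltW K_gt0) //; apply: ler_powR => //; lra.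
have KqX : T * (q0 * X) <= K.
  rewrite /q0 /X -powRD; last by apply/implyP => _; rewrite gt_eqF.
  apply: (@le_trans _ _ (powR K eps * powR K (c0 R - 2 * eps + (1 - c0 R + eps)))).
    by rewrite ler_wpM2r ?powR_ge0.
  rewrite -powRD; last by apply/implyP => _; rewrite gt_eqF.
  rewrite (_ : eps + (c0 R - 2 * eps + (1 - c0 R + eps)) = 1); last by ring.
  by rewrite powRr1 ?(ltW K_gt0).
rewrite TE in KqX; have XqX : X <= q0 * X by rewrite ler_peMl //; lra.
pose kap := trunc_log 2 k; pose sig := (Num.truncn X).+1.
have k_gt0n : (0 < k)%N by rewrite -(ltr_nat R).
have kap_le : (2 ^ kap <= k)%N by apply: trunc_logP.
have kap_gt : (k < 2 ^ kap.+1)%N by apply: trunc_log_ltn.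
have lnX i : ln (2%:R ^+ i : R) = i%:R * ln 2 by rewrite lnXn // mulr_natl.
have kapK : kap%:R <= K.
  rewrite /K /log2 ler_pdivlMr // -lnX ler_ln ?posrE ?exprn_gt0 //.
  by rewrite -natrX ler_nat.
have Kkap : K < kap%:R + 1.
  rewrite /K /log2 ltr_pdivrMr // natr1 -lnX ltr_ln ?posrE ?exprn_gt0 //.
  by rewrite -natrX ltr_nat.
have /truncn_itv/andP[sig_le sig_gt] : 0 <= X by lra.
have sigX : sig%:R <= 2 * X by rewrite /sig -natr1; lra.
have dX : (kap %/ sig)%:R <= X.
  apply: (@le_trans _ _ (kap%:R / sig%:R)).
    by rewrite ler_pdivlMr ?ltr0n // -natrM ler_nat leq_trunc_div.
  rewrite ler_pdivrMr ?ltr0n //; apply: le_trans kapK (le_trans KX _).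
  by rewrite ler_wpM2l //; [lra|exact: ltW].
have kap16 : kap%:R < 16 * (kap %/ 16)%:R + 16 :> R.
  have : (kap < 16 * (kap %/ 16) + 16)%N by rewrite {1}(divn_eq kap 16) mulnC ltn_add2l ltn_pmod.
  by rewrite -(ltr_nat R) natrD natrM.
have [|||||V [cap [term [capS [cap1 [termI H]]]]]] :=
  @cell_graph_quality R k kap sig q0 kap_le kap_gt => //.
- by rewrite -(ler_nat R) natrM; clear -sigX XqX KqX K64 Kkap; lra.
- by rewrite -(ler_nat R); clear -K64 Kkap; lra.
- exact: lt_le_trans q0_ge1.
- have -> : ((2 * sig).+1 + (kap %/ sig).+2)%:R = 2 * sig%:R + (kap %/ sig)%:R + 3 :> R.
    rewrite -[(2 * sig).+1]addn1 -[(kap %/ sig).+2]addn2 addnACA.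
    by rewrite (natrD _ (_ + _)) natrD natrM.
  have : q0 * (2 * sig%:R + (kap %/ sig)%:R + 3) <= q0 * (8 * X).
    by rewrite ler_wpM2l //; [apply: le_trans q0_ge1|clear -sigX dX X_ge1; lra].
  by clear -KqX K64 kap16 Kkap; lra.
exists V, cap, term; do 3!split=> //; move=> n m p lam pc mle q qP.
apply: (H n m p lam pc _ q qP) => i; rewrite -(ler_nat R) natrM.
apply: le_trans (mle i) _; rewrite ler_wpM2l ?ler0n // -/X natrX -powR_mulrn //.
by apply: ler_powR; [lra|exact: ltW].
Qed.
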